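(* For all integers $m,n$ with $m \leq n \leq 1.699(m+1)$, $$r(S(n,m)) \leq n+2m+2.$$
   Context: For integers $n \geq m \geq 0$, the double star $S(n,m)$ is the graph consisting of the union of two stars $K_{1,n}$ and $K_{1,m}$ together with an edge (the bridge) joining the centers of these two stars. For a graph $G$, the Ramsey number $r(G)$ is the least integer $N$ such that every 2-coloring of the edges of the complete graph $K_N$ contains a monochromatic copy of $G$. Here $m \geq 0$ is an integer. *)

(* Defs.v *)
From mathcomp Require Import all_boot.

Set Implicit Arguments.
Unset Strict Implicit.
Unset Printing Implicit Defensive.

Record sgraph := SGraph {
  vertex : finType;
  edge : rel vertex;
  edge_sym : symmetric edge;
  edge_irrefl : irreflexive edge }.

(* The colour of the edge xy of K_N is [c [set x; y]]; the values of [c] on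
   sets that do not have exactly two elements play no role.  The copy of [G]
   is a subgraph, not necessarily induced. *)
Definition mono_copy (G : sgraph) (N : nat) (c : {ffun {set 'I_N} -> bool})
    (b : bool) : bool :=
  [exists f : {ffun vertex G -> 'I_N}, injectiveb f &&
    [forall x, forall y, edge x y ==> (c [set f x; f y] == b)]].

Definition arrows (G : sgraph) (N : nat) : bool :=
  [forall c : {ffun {set 'I_N} -> bool}, [exists b, mono_copy G c b]].

Lemma mono_clique (T : finType) (c : {set T} -> bool) (k l : nat) (A : {set T}) :
  2 ^ (k + l) <= #|A| ->
  exists b (B : {set T}), [/\ B \subset A, #|B| = if b then k else l &
    {in B &, forall x y, x != y -> c [set x; y] = b}].
Proof.
move Dn: (k + l) => n.
elim: n k l A Dn => [|n IHn] k l A Dn leA.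
  exists true, set0; split; rewrite ?sub0set ?cards0 //; first by case: k Dn.
  by move=> x y; rewrite inE.
case: k Dn => [|k] Dn.
  by exists true, set0; split; rewrite ?sub0set ?cards0 // => x y; rewrite inE.
case: l Dn => [|l] Dn.
  by exists false, set0; split; rewrite ?sub0set ?cards0 // => x y; rewrite inE.
have /card_gt0P[x xA]: 0 < #|A| by apply: leq_trans leA; rewrite expn_gt0.
pose D b := [set y in A :\ x | c [set x; y] == b].
have cardD : #|A| = (#|D true| + #|D false|).+1.
  rewrite (cardsD1 x) xA add1n; congr _.+1.
  rewrite -(cardsID [set y | c [set x; y]] (A :\ x)); congr (_ + _);
    by apply: eq_card => y; rewrite !inE; case: (c _); rewrite ?andbT ?andbF.
have [b leD] : exists b, 2 ^ n <= #|D b|.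
  have [?|ltD] := leqP (2 ^ n) #|D true|; first by exists true.
  exists false; move: leA; rewrite cardD expnS mul2n -addnn -addnS => leA.
  rewrite -(leq_add2l (2 ^ n)) (leq_trans leA) // addnS -addSn.
  by rewrite leq_add2r.
have Dn' : (if b then k else k.+1) + (if b then l.+1 else l) = n.
  by case: b {leD}; apply: succn_inj; rewrite -Dn ?addSn ?addnS.
have [b' [B [sBD cardB monoB]]] := IHn _ _ _ Dn' leD.
have sBA : B \subset A.
  by apply/subsetP => y /(subsetP sBD); rewrite !inE => /andP[/andP[]].
have xB : x \notin B by apply/negP => /(subsetP sBD); rewrite !inE eqxx.
have [eb | neb] := eqVneq b' b; last first.
  exists b', B; split=> //; rewrite cardB.
  by case: b b' neb {leD Dn' sBD monoB cardB} => [] [].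
subst b'; exists b, (x |: B); split.
- by rewrite subUset sub1set xA.
- by rewrite cardsU1 xB cardB; case: (b).
have cx y : y \in B -> c [set x; y] = b.
  by move/(subsetP sBD); rewrite !inE => /andP[_ /eqP].
move=> y z /setU1P[->|yB] /setU1P[->|zB]; rewrite ?eqxx // => nyz.
- exact: cx.
- by rewrite setUC; apply: cx.
- exact: monoB.
Qed.

Lemma arrows_exists (G : sgraph) : exists N, arrows G N.
Proof.
pose v := #|vertex G|; exists (2 ^ (v + v)).
apply/forallP => c.
have [|b [B [_ cardB monoB]]] := @mono_clique _ c v v setT.
  by rewrite cardsT card_ord.
have {}cardB : v = #|B| by rewrite cardB; case: (b).
pose f x := enum_val (cast_ord cardB (enum_rank x)).
have f_inj : injective f.
  by move=> x y /enum_val_inj /cast_ord_inj /enum_rank_inj.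
apply/existsP; exists b; apply/existsP; exists (finfun f); apply/andP; split.
  by apply/injectiveP => x y; rewrite !ffunE; apply: f_inj.
apply/forallP => x; apply/forallP => y; apply/implyP => xy; rewrite !ffunE.
apply/eqP/monoB; rewrite ?enum_valP // (inj_eq f_inj).
by apply: contraTneq xy => ->; rewrite edge_irrefl.
Qed.

Definition ramsey (G : sgraph) : nat := ex_minn (arrows_exists G).

(* The star K_{1,k}: [None] is the centre and the [Some i] are the leaves. *)
Definition star_edge (k : nat) : rel (option 'I_k) :=
  fun x y => isSome x != isSome y.

Definition double_star_edge (n m : nat) : rel (option 'I_n + option 'I_m) :=
  fun u v => match u, v with
  | inl x, inl y => star_edge x y
  | inr x, inr y => star_edge x y
  | inl x, inr y => (x == None) && (y == None)
  | inr x, inl y => (x == None) && (y == None)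
  end.

Lemma double_star_edge_sym n m : symmetric (@double_star_edge n m).
Proof.
by move=> [x|x] [y|y] //=; rewrite 1?andbC // /star_edge eq_sym.
Qed.

Lemma double_star_edge_irrefl n m : irreflexive (@double_star_edge n m).
Proof. by move=> [x|x] /=; rewrite /star_edge eqxx. Qed.

Definition double_star (n m : nat) : sgraph :=
  SGraph (@double_star_edge_sym n m) (@double_star_edge_irrefl n m).

(* Main.v *)
Require Import Defs.
From Stdlib Require Import BinInt.
From mathcomp Require Import all_boot all_order all_algebra.
From mathcomp Require Import ssrZ zify.
Set Implicit Arguments.
Unset Strict Implicit.
Unset Printing Implicit Defensive.
Import Order.TTheory GRing.Theory Num.Theory.
Local Open Scope ring_scope.

(** The loops make the flag algebra argument exact for finite N. The sums run over all k-tuples of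
    vertices, repetitions included, so the two flags of a product are chosen independently and, for
    fixed roots, their sum is literally a sum of squares, without error terms of order 1/N. A tuple
    with repetitions must then induce a graph as well, and the loop at x tells how two copies of x
    are joined. Giving the loop the colour of large degree keeps both families of inequalities true
    on such tuples: the loop is not among the at most n edges of the other colour at x, and the pair
    (x, x), which has the colour of the loop, has M common neighbours because x has degree at least
    M in the other colour.

    The step with k = 4 makes the one with k = 7 affordable: once all loops agree, exchanging the
    colours if necessary leaves only loopless graphs on seven vertices to enumerate. *)

(** Put M = m + 1, N = n + 2m + 2 = n + 2M, and suppose that a 2-colouring of K_N
has no monochromatic S(n,m), with n > 0. Every vertex has degree at least M in both colours,
and the ends of an edge of colour k, one of which has k-degree more than n, have at
least M common neighbours in the other colour. Double counting between the two
neighbourhoods of a vertex shows that no vertex has degree more than n in both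
colours. Except for three small pairs (m,n) with n = 2m + 1, settled by parity,
every vertex therefore has exactly one colour of degree more than n; give the vertex
a loop of that colour. In the resulting looped 2-coloured complete graph, every
vertex x sends at most n edges of the colour other than that of its loop, and if the
edge xy has the colour of the loop at x, then x and y have at least M common
neighbours in the other colour; moreover n <= 1699/3699 N and M >= 1000/3699 N.

These two families of inequalities are contradictory by flag algebras. A nonnegative
combination of squares of flag sums and of multiples of the inequalities is a sum
over k-tuples of vertices of a function of the induced subgraph. For k = 4 this
function is nonpositive and negative as soon as both kinds of loops occur, so all
loops have the same colour; for k = 7 it is negative on all loopless graphs. The
two certificates were found by semidefinite programming and rounded to integers. *)

(** * Tries and sums over orderings *)

Inductive trie (A : Type) := Nil | Leaf of A | Node of trie A & trie A.
Arguments Nil {A}.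

Fixpoint walk A (T : trie A) (s : seq bool) : trie A :=
  match s, T with
  | [::], _ => T
  | b :: s', Node l r => walk (if b then r else l) s'
  | _ :: _, _ => Nil
  end.

Fixpoint tmap A B (f : A -> B) (T : trie A) : trie B :=
  match T with
  | Nil => Nil
  | Leaf a => Leaf (f a)
  | Node l r => Node (tmap f l) (tmap f r)
  end.

Fixpoint tall A (p : A -> bool) (T : trie A) : bool :=
  match T with
  | Nil => true
  | Leaf a => p a
  | Node l r => tall p l && tall p r
  end.

Lemma walk_Nil A s : walk (@Nil A) s = Nil.
Proof. by case: s. Qed.

Lemma walk_cat A (T : trie A) s1 s2 : walk T (s1 ++ s2) = walk (walk T s1) s2.
Proof. by elim: s1 T => [|b s1 IH] [|a|l r] //=; case: (s2). Qed.

Lemma walk_tmap A B (f : A -> B) T s : walk (tmap f T) s = tmap f (walk T s).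
Proof. by elim: s T => [|b s IH] [|a|l r] //=; rewrite -IH; case: b. Qed.

Lemma tall_walk A (p : A -> bool) T s : tall p T -> tall p (walk T s).
Proof. by elim: s T => [|b s IH] [|a|l r] //= /andP[Hl Hr]; apply: IH; case: b. Qed.

(** A sum that computes, for the checks run inside the kernel; the proofs turn it into [\sum]. *)
Fixpoint zsum A (f : A -> Z) (s : seq A) : Z :=
  if s is x :: s' then Z.add (f x) (zsum f s') else Z0.

Lemma zsumE A (f : A -> Z) s : zsum f s = \sum_(x <- s) f x.
Proof. by elim: s => [|x s IH]; rewrite ?big_nil ?big_cons //= IH. Qed.

Fixpoint picks A (s : seq A) : seq (A * seq A) :=
  if s is x :: s' then (x, s') :: [seq (p.1, x :: p.2) | p <- picks s'] else [::].

Section Dfs.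
Variables (X : Type) (e : X -> X -> bool).

Definition row x (pre : seq X) : seq bool := e x x :: [seq e x y | y <- pre].

(** The lower triangle of the adjacency matrix with its diagonal, row by row. Adding a vertex
    appends a row, so a walk in a trie can be continued vertex by vertex. *)
Fixpoint code (pre q : seq X) : seq bool :=
  if q is x :: q' then row x pre ++ code (rcons pre x) q' else [::].

(* The sum of [k a (pre ++ q) r] over all ways of choosing an ordered [q] of length
   [n] from [rest], leaving [r], such that the code of [q] relative to [pre] leads to
   a leaf [a] of [T]; branches whose code leaves the trie are cut early. *)
Fixpoint dfs A n (T : trie A) (k : A -> seq X -> seq X -> Z) (pre rest : seq X) : Z :=
  match n, T with
  | 0, Leaf a => k a pre rest
  | n'.+1, (Leaf _ | Node _ _) =>
      zsum (fun p => dfs n' (walk T (row p.1 pre)) k (rcons pre p.1) p.2) (picks rest)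
  | _, _ => Z0
  end.

(** Cutting branches early does not change the sum: a nonempty row leads from [Nil] to [Nil], and
    below [Nil] every term is zero. So the plain recursion holds for every trie. *)
Lemma dfsS A n (T : trie A) k pre rest :
  dfs n.+1 T k pre rest =
  zsum (fun p => dfs n (walk T (row p.1 pre)) k (rcons pre p.1) p.2) (picks rest).
Proof.
by case: T => //=; rewrite zsumE big1 // => p _; case: (n).
Qed.

Fixpoint dot (u v : seq Z) : Z :=
  match u, v with
  | x :: u', y :: v' => Z.add (Z.mul x y) (dot u' v')
  | _, _ => Z0
  end.

(** The certificate stores factor vectors of the Gram matrices, which makes them positive
    semidefinite by construction. The products are formed once, before the enumeration. *)
Definition gram (R : trie (seq Z)) : trie (trie Z) := tmap (fun u => tmap (dot u) R) R.

(* The leaves of [Q] are Gram matrices of flags with [s] roots and [w] further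
   vertices; the two flags of a product use disjoint sets of further vertices. *)
Definition sqsum s w (Q : trie (trie (trie Z))) (t : seq X) : Z :=
  dfs s Q (fun A pre r =>
    dfs w A (fun B _ r' => dfs w B (fun z _ _ => z) pre r') pre r) [::] t.

Variables a b c : Z.

(** The first chosen vertex [x] is the one whose inequality is used. Summed over all [w] in the
    vertex set, the bracket is [a] N minus [c] times the number of edges at [x] that differ from its
    loop; the multiplier [h] depends on all [n] chosen vertices. *)
Definition degsum n (D : trie Z) (t : seq X) : Z :=
  dfs n D (fun h pre r =>
    if pre is x :: _ then
      zsum (fun w => Z.mul h (Z.sub a (if e x w == e x x then Z0 else c))) r
    else Z0) [::] t.

(** The same for the common neighbours of the first two chosen vertices; the bracket sums to [c]
    times their number minus [b] N. *)
Definition cdgsum n (D : trie Z) (t : seq X) : Z :=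
  dfs n D (fun h pre r =>
    if pre is x :: y :: _ then
      if e x y == e x x then
        zsum (fun w => Z.mul h
          (Z.sub (if (e x w == e x x) || (e y w == e x x) then Z0 else c) b)) r
      else Z0
    else Z0) [::] t.

End Dfs.

(** An entry of [squares] gives the number of roots, the number of further vertices of a flag, and
    the flag vectors, indexed by the code of the roots and then by that of the further vertices.
    [kappa] balances the integer scale of the squares against that of the multipliers. *)
Record cert := Cert {
  kappa : Z;
  squares : seq (nat * nat * trie (trie (seq Z)));
  degs : trie Z;
  cdgs : trie Z }.

Definition grams (C : cert) := [seq (p.1, tmap gram p.2) | p <- squares C].

Definition value X (e : X -> X -> bool) a b c K (kap : Z) Q D D' (t : seq X) : Z :=
  Z.add (Z.mul kap (zsum (fun p : nat * nat * _ => sqsum e p.1.1 p.1.2 p.2 t) Q))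
    (Z.add (degsum e a c K.-1 D t) (cdgsum e b c K.-1 D' t)).

(** * Sums over all tuples of vertices *)

Section SumV.
Variable V : finType.
Implicit Type G : seq V -> Z.

Fixpoint sumV k G : Z :=
  if k is k'.+1 then \sum_(x : V) sumV k' (fun s => G (x :: s)) else G [::].

Lemma sumVS k G : sumV k.+1 G = \sum_(x : V) sumV k (fun s => G (x :: s)).
Proof. by []. Qed.

Lemma eq_sumV k G G' : (forall s, size s = k -> G s = G' s) -> sumV k G = sumV k G'.
Proof.
elim: k G G' => [|k IH] G G' E /=; first exact: E.
by apply: eq_bigr => x _; apply: IH => s sk; apply: E; rewrite /= sk.
Qed.

Lemma sumV_ge0 k G : (forall s, size s = k -> 0 <= G s) -> 0 <= sumV k G.
Proof.
elim: k G => [|k IH] G E /=; first exact: E.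
by apply: sumr_ge0 => x _; apply: IH => s sk; apply: E; rewrite /= sk.
Qed.

Lemma sumV_sum I (r : seq I) k (G : I -> seq V -> Z) :
  sumV k (fun s => \sum_(i <- r) G i s) = \sum_(i <- r) sumV k (G i).
Proof.
elim: k G => //= k IH G; rewrite exchange_big /=.
by apply: eq_bigr => x _; rewrite IH.
Qed.

Lemma sumVD k G G' : sumV k (fun s => G s + G' s) = sumV k G + sumV k G'.
Proof.
elim: k G G' => //= k IH G G'; rewrite -big_split.
by apply: eq_bigr => x _; rewrite IH.
Qed.

Lemma sumVMl k z G : sumV k (fun s => z * G s) = z * sumV k G.
Proof.
elim: k G => //= k IH G; rewrite big_distrr.
by apply: eq_bigr => x _; rewrite IH.
Qed.

Lemma sumV0 k : sumV k (fun _ => 0) = 0.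
Proof. by elim: k => //= k IH; rewrite big1. Qed.

(* Each of the [k.+1] positions of the picked element contributes the same sum, so
   the sums over orderings below are multiples of iterated sums over [V]. *)
Lemma sumV_picks k (G : V -> seq V -> Z) :
  sumV k.+1 (fun t => \sum_(p <- picks t) G p.1 p.2) =
  (\sum_(x : V) sumV k (G x)) *+ k.+1.
Proof.
elim: k G => [|k IH] G.
  by rewrite /= mulr1n; apply: eq_bigr => x _; rewrite big_seq1.
rewrite [LHS]sumVS; transitivity (\sum_(x : V) (sumV k.+1 (G x) +
                            (\sum_(y : V) sumV k (fun s => G y (x :: s))) *+ k.+1)).
  apply: eq_bigr => x _; rewrite -(IH (fun y s => G y (x :: s))) -sumVD.
  by apply: eq_sumV => s _; rewrite big_cons big_map.
rewrite big_split /= [in RHS]mulrSr addrC; congr (_ + _).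
rewrite sumrMnl; congr (_ *+ _).
by rewrite exchange_big.
Qed.

End SumV.

(** * Nonnegativity of the sum of the values over all tuples *)

Section DfsSum.
Variables (V : finType) (e : V -> V -> bool).

(** The averaging identity of flag algebras. In a sum over all tuples it does not matter which
    positions are chosen, and there are [(n + m) ^_ n] ordered choices of [n] positions. Afterwards
    the chosen vertices and the [m] others range independently, which is what lets products of flags
    factor. *)
Lemma dfs_sum A n m (T : trie A) k pre :
  sumV (n + m) (dfs e n T k pre) =
  sumV n (fun q => if walk T (code e pre q) is Leaf a
                   then sumV m (k a (pre ++ q)) else 0) *+ (n + m) ^_ n.
Proof.
elim: n T pre => [|n IH] T pre.
  by rewrite /= ffactn0 mulr1n cats0; case: T => //=; rewrite ?sumV0.
rewrite addSn (@eq_sumV V _ _ (fun t => \sum_(p <- picks t)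
  dfs e n (walk T (row e p.1 pre)) k (rcons pre p.1) p.2)); last first.
  by move=> t _; rewrite dfsS zsumE.
rewrite (sumV_picks _ (fun x r => dfs e n (walk T (row e x pre)) k (rcons pre x) r)).
rewrite sumVS ffactSS mulnC mulrnA; congr (_ *+ _); rewrite -sumrMnl.
apply: eq_bigr => x _; rewrite IH; congr (_ *+ _).
by apply: eq_sumV => q _; rewrite cat_rcons -walk_cat.
Qed.

Lemma dfs_ge0 A n m (P : A -> bool) (T : trie A) k pre :
  tall P T -> (forall a pre', P a -> 0 <= sumV m (k a pre')) ->
  0 <= sumV (n + m) (dfs e n T k pre).
Proof.
move=> PT H; rewrite dfs_sum mulrn_wge0 //; apply: sumV_ge0 => q _.
by case E: (walk _ _) => [|a|] //; apply: H; have := tall_walk (code e pre q) PT; rewrite E.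
Qed.

(** A common bound on the lengths turns all the products [dot] into sums over one index set, so that
    they can be exchanged with the sums over vertices. *)
Lemma trie_bound (R : trie (seq Z)) :
  exists d, forall s u, walk R s = Leaf u -> (size u <= d)%N.
Proof.
elim: R => [|u|l [dl Hl] r [dr Hr]].
- by exists 0%N => s u; rewrite walk_Nil.
- by exists (size u) => -[|b s] v //=; rewrite ?walk_Nil // => -[<-].
exists (maxn dl dr) => -[|b s] u //= E; rewrite leq_max.
by case: b E => E; rewrite ?(Hl _ _ E) ?(Hr _ _ E) ?orbT.
Qed.

Lemma dotE u v d : (size u <= d)%N -> dot u v = \sum_(i < d) u`_i * v`_i.
Proof.
elim: u v d => [|x u IH] v d /=.
  by move=> _; rewrite big1 // => i _; rewrite nth_nil mul0r.
case: d => // d; rewrite ltnS; case: v => [|y v] ud.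
  by rewrite big1 // => i _; rewrite nth_nil mulr0.
by rewrite big_ord_recl /= (IH v d).
Qed.

(** For fixed roots [pre], the sum is a nonnegative multiple of the squared norm of the sum of the
    flag vectors over all choices of the [w] further vertices. *)
Lemma gram_ge0 w (R : trie (seq Z)) pre :
  0 <= sumV (w + w) (fun r => dfs e w (gram R)
         (fun B _ r' => dfs e w B (fun z _ _ => z) pre r') pre r).
Proof.
rewrite dfs_sum mulrn_wge0 //.
(* Flags absent from the trie get the empty vector, read as zero. *)
pose vec q := if walk R (code e pre q) is Leaf u then u else [::].
have [d Hd] := trie_bound R.
have sz q : (size (vec q) <= d)%N.
  by rewrite /vec; case E: (walk _ _) => [|u|] //; apply: Hd E.
rewrite (@eq_sumV V _ _ (fun q => sumV w (fun q' => dot (vec q) (vec q')) *+ w ^_ w)); last first.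
  move=> q _; rewrite /gram walk_tmap /vec.
  case E: (walk R (code e pre q)) => [|u|l r] /=; rewrite ?sumV0 ?mul0rn //.
  rewrite -{1}[w]addn0 dfs_sum addn0; congr (_ *+ _).
  apply: eq_sumV => q' _; rewrite walk_tmap.
  by case: (walk R _) => //=; rewrite ?(dotE _ (leqnn _)) ?big1 // => i _; rewrite nth_nil mulr0.
rewrite (@eq_sumV V _ _ (fun q => (w ^_ w)%:R * \sum_(i < d)
   (vec q)`_i * sumV w (fun q' => (vec q')`_i))); last first.
  move=> q _; rewrite mulr_natl; congr (_ *+ _).
  rewrite (@eq_sumV V _ _ (fun q' => \sum_(i < d) (vec q)`_i * (vec q')`_i)); last first.
    by move=> q' _; apply: dotE.
  by rewrite sumV_sum; apply: eq_bigr => i _; rewrite sumVMl.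
rewrite sumVMl mulr_ge0 // ?ler0n // sumV_sum sumr_ge0 // => i _.
(* Coordinate by coordinate, the double sum is the square of a single sum. *)
rewrite (@eq_sumV V _ _ (fun q => sumV w (fun q' => (vec q')`_i) * (vec q)`_i)).
  by rewrite sumVMl -expr2 sqr_ge0.
by move=> q _; rewrite mulrC.
Qed.

Lemma sqsum_ge0 s w (S : trie (trie (seq Z))) :
  0 <= sumV (s + (w + w)) (sqsum e s w (tmap gram S)).
Proof.
rewrite dfs_sum mulrn_wge0 //; apply: sumV_ge0 => q _.
by rewrite walk_tmap; case: (walk S _) => //= R; apply: gram_ge0.
Qed.

Variables a b c : Z.
Hypothesis degP : forall x, c * #|[set y | e x y != e x x]|%:R <= a * #|V|%:R.
Hypothesis cdgP : forall x y, e x y = e x x ->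
  b * #|V|%:R <= c * #|[set z | (e x z != e x x) && (e y z != e x x)]|%:R.

Lemma degsum_ge0 n (D : trie Z) : tall (Z.leb 0) D -> 0 <= sumV (n + 1) (degsum e a c n D).
Proof.
move=> D0; apply: (@dfs_ge0 _ _ _ (Z.leb 0) D) => // h [|x pre] /Z.leb_le h0.
  by rewrite sumV0.
(* Only one vertex [w] is left, so the inner [zsum] has a single term. *)
rewrite sumVS (eq_bigr (fun w => h * (a - (if e x w == e x x then 0 else c)))); last first.
  by move=> w _; exact: addr0.
rewrite -big_distrr mulr_ge0 //=; first by lia.
rewrite sumrB sumr_const -mulr_natr subr_ge0 (le_trans _ (degP x)) //.
rewrite -sum1dep_card natr_sum big_distrr /= [leRHS]big_mkcond /=.
by apply: ler_sum => w _; case: eqP => //= _; rewrite mulr1.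
Qed.

Lemma cdgsum_ge0 n (D : trie Z) : tall (Z.leb 0) D -> 0 <= sumV (n + 1) (cdgsum e b c n D).
Proof.
move=> D0; apply: (@dfs_ge0 _ _ _ (Z.leb 0) D) => // h [|x [|y pre]] /Z.leb_le h0;
  rewrite ?sumV0 //.
case: eqP => [exy|_]; last by rewrite sumV0.
rewrite sumVS (eq_bigr (fun w => h *
    ((if (e x w == e x x) || (e y w == e x x) then 0 else c) - b))); last first.
  by move=> w _; exact: addr0.
rewrite -big_distrr mulr_ge0 //=; first by lia.
rewrite sumrB sumr_const -mulr_natr subr_ge0 (le_trans (cdgP exy)) //.
rewrite -sum1dep_card natr_sum big_distrr /= [leLHS]big_mkcond /=.
by apply: ler_sum => w _; rewrite -negb_or; case: (_ || _) => //=; rewrite mulr1.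
Qed.

Definition cert_ok K (C : cert) :=
  [&& Z.leb 0 (kappa C),
      all (fun p : nat * nat * _ => p.1.1 + p.1.2 + p.1.2 == K)%N (squares C),
      tall (Z.leb 0) (degs C) & tall (Z.leb 0) (cdgs C)].

(** One half of the contradiction: the total is nonnegative. The finite check will supply the
    opposite sign term by term. *)
Lemma value_ge0 K (C : cert) : (0 < K)%N -> cert_ok K C ->
  0 <= sumV K (value e a b c K (kappa C) (grams C) (degs C) (cdgs C)).
Proof.
move=> K0 /and4P[/Z.leb_le k0 sqK D0 D0'].
rewrite /value sumVD sumVD sumVMl addr_ge0 //.
  rewrite mulr_ge0 //; first by lia.
  rewrite (@eq_sumV V _ _ (fun t => \sum_(p <- squares C)
    sqsum e p.1.1 p.1.2 (tmap gram p.2) t)); last first.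
    by move=> t _; rewrite zsumE /grams big_map.
  rewrite sumV_sum; elim: (squares C) sqK => [|p s IH] /=; rewrite ?big_nil //.
  case/andP=> /eqP pK /IH; rewrite big_cons; apply: addr_ge0.
  by rewrite -pK -addnA sqsum_ge0.
have eK : (K.-1 + 1 = K)%N by rewrite addn1 prednK.
by apply: addr_ge0; rewrite -{1}eK; [exact: degsum_ge0 | exact: cdgsum_ge0].
Qed.

End DfsSum.

(** * Invariance of the value under reordering and relabelling *)

Section Perm.

Lemma dfs_map (X Y : Type) (f : X -> Y) (e : X -> X -> bool) (e' : Y -> Y -> bool)
    A n (T : trie A) k k' pre rest :
  (forall x y, e x y = e' (f x) (f y)) ->
  (forall a p r, k a p r = k' a (map f p) (map f r)) ->
  dfs e n T k pre rest = dfs e' n T k' (map f pre) (map f rest).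
Proof.
move=> Ee Ek; elim: n T pre rest => [|n IH] T pre rest; first by case: T => //=.
have Epicks : picks (map f rest) = [seq (f p.1, map f p.2) | p <- picks rest].
  elim: rest => //= x rest ->; congr (_ :: _).
  by rewrite -!map_comp; apply: eq_map => p.
rewrite !dfsS !zsumE Epicks big_map; apply: eq_bigr => p _.
rewrite IH map_rcons; congr (dfs _ _ (walk _ _) _ _ _).
by rewrite /row Ee -map_comp; congr (_ :: _); apply: eq_map => y /=.
Qed.

(** [picks] chooses positions and [rem] deletes first occurrences. With repeated entries these
    differ only in the order of what is left, to which [G] is blind. *)
Lemma picks_rem (X : eqType) (G : X -> seq X -> Z) (s : seq X) :
  (forall x r r', perm_eq r r' -> G x r = G x r') ->
  \sum_(p <- picks s) G p.1 p.2 = \sum_(x <- s) G x (rem x s).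
Proof.
elim: s G => [|x s IH] G PG; rewrite ?big_nil // [picks _]/= !big_cons big_map /= eqxx.
congr (_ + _); rewrite (IH (fun y r => G y (x :: r))); last first.
  by move=> y r r' rr; apply: PG; rewrite perm_cons.
(* If [y] equals the head [x], then [rem] deletes the head instead of the later occurrence; the two
   remainders are permutations of each other. *)
rewrite !big_seq; apply: eq_bigr => y ys; case: eqP => // <-{y}in ys *.
by apply: PG; rewrite perm_sym perm_to_rem.
Qed.

Variables (X : eqType) (e : X -> X -> bool).

Lemma dfs_perm A n (T : trie A) k pre r r' :
  (forall a p r1 r2, perm_eq r1 r2 -> k a p r1 = k a p r2) ->
  perm_eq r r' -> dfs e n T k pre r = dfs e n T k pre r'.
Proof.
move=> Pk; elim: n T pre r r' => [|n IH] T pre r r' rr'.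
  by case: T => //= a; apply: Pk.
pose G x s := dfs e n (walk T (row e x pre)) k (rcons pre x) s.
have PG x s s' : perm_eq s s' -> G x s = G x s' by apply: IH.
rewrite !dfsS !zsumE !(picks_rem (G := G)) // (perm_big _ rr') /=.
rewrite !big_seq; apply: eq_bigr => x xr'; apply: PG.
have xr : x \in r by rewrite (perm_mem rr').
rewrite -(perm_cons x) -(permPl (perm_to_rem xr)) perm_sym.
by rewrite -(permPl (perm_to_rem xr')) perm_sym.
Qed.

Lemma zsum_perm (f : X -> Z) r r' : perm_eq r r' -> zsum f r = zsum f r'.
Proof. by move=> rr; rewrite !zsumE (perm_big _ rr). Qed.

(** This is what allows the check to look at one ordering of each graph only. *)
Lemma value_perm a b c K kap Q D D' t t' : perm_eq t t' ->
  value e a b c K kap Q D D' t = value e a b c K kap Q D D' t'.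
Proof.
move=> tt'; rewrite /value; congr (Z.add (Z.mul _ _) (Z.add _ _)).
- rewrite !zsumE; apply: eq_bigr => -[[s w] q] _ /=; apply: dfs_perm => // A p r r' rr.
  apply: dfs_perm => // B p' r1 r2 rr'; exact: dfs_perm.
- apply: dfs_perm => // h [|x p] r r' rr //; exact: zsum_perm.
- apply: dfs_perm => // h [|x [|y p]] r r' rr //; case: ifP => // _; exact: zsum_perm.
Qed.

End Perm.

Lemma value_map (X Y : Type) (f : X -> Y) (e : X -> X -> bool) (e' : Y -> Y -> bool)
    a b c K kap Q D D' t :
  (forall x y, e x y = e' (f x) (f y)) ->
  value e a b c K kap Q D D' t = value e' a b c K kap Q D D' (map f t).
Proof.
move=> Ee; rewrite /value; congr (Z.add (Z.mul _ _) (Z.add _ _)).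
- rewrite !zsumE; apply: eq_bigr => -[[s w] q] _ /=.
  rewrite /sqsum (@dfs_map _ _ f e e' _ _ _ _ (fun A pre r =>
    dfs e' w A (fun B _ r' => dfs e' w B (fun z _ _ => z) pre r') pre r)) // => A p r.
  by apply: dfs_map => // B _ r'; apply: dfs_map.
- apply: dfs_map => // h [|x p] r //=; rewrite !zsumE big_map.
  by apply: eq_bigr => w _; rewrite !Ee.
- apply: dfs_map => // h [|x [|y p]] r //=; rewrite !Ee; case: ifP => // _.
  by rewrite !zsumE big_map; apply: eq_bigr => w _; rewrite !Ee.
Qed.

(** * Enumeration of graphs up to isomorphism *)

Definition bmx := seq (seq bool).

Definition mrel (M : bmx) i j : bool := nth false (nth [::] M i) j.

Definition extend (M : bmx) (s : seq bool) (l : bool) : bmx :=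
  rcons [seq rcons p.1 p.2 | p <- zip M s] (rcons s l).

Definition relabel (p : seq nat) (M : bmx) : bmx :=
  [seq [seq nth false r j | j <- p] | r <- [seq nth [::] M i | i <- p]].

Fixpoint bitseqs n : seq (seq bool) :=
  if n is n'.+1 then
    [seq true :: s | s <- bitseqs n'] ++ [seq false :: s | s <- bitseqs n']
  else [:: [::]].

(* Each graph is extended only by vertices that become of maximal degree: every
   graph arises this way, by removing such a vertex, and there are fewer extensions
   to consider. *)
Definition last_max (M : bmx) : bool :=
  all (fun r => count id r <= count id (last [::] M))%N M.

Definition extensions (ls : seq bool) (M : bmx) : seq bmx :=
  [seq N <- [seq extend M s l | s <- bitseqs (size M), l <- ls] | last_max N].

Fixpoint lexn (s t : seq nat) : bool :=
  match s, t with
  | x :: s', y :: t' => (x < y)%N || (x == y) && lexn s' t'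
  | [::], _ => true
  | _, [::] => false
  end.

(** Degrees and sums of neighbouring degrees come first, so that the greedy search begins by sorting
    the vertices by these invariants; the matrix itself breaks the remaining ties. Only the speed
    depends on this choice. *)
Definition bmx_key (M : bmx) : seq nat :=
  let d := [seq count id r | r <- M] in
  d ++ [seq sumn (mask r d) | r <- M] ++ [seq nat_of_bool b | b <- flatten M].

Definition swaps k : seq (seq nat) :=
  [seq [seq (if x == p.1 then p.2 else if x == p.2 then p.1 else x) | x <- iota 0 k]
  | p <- [seq (i, j) | j <- iota 0 k, i <- iota 0 j]].

(* A greedy search for a small key by transpositions. The result need not be
   canonical: isomorphic duplicates only cost time. *)
Definition reduce (ps : seq (seq nat)) (M : bmx) : bmx :=
  (foldl (fun kN p => let N' := relabel p kN.2 in let k' := bmx_key N' in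
            if lexn kN.1 k' then kN else (k', N')) (bmx_key M, M) ps).2.

Fixpoint dedup (T : eqType) (x : T) (s : seq T) : seq T :=
  if s is y :: s' then if x == y then dedup x s' else x :: dedup y s' else [:: x].

(** Sorting brings equal matrices together, so comparing neighbours removes the duplicates. The keys
    are computed once and travel with the matrices. *)
Definition undup_sort (s : seq bmx) : seq bmx :=
  let leq_key x y := lexn x.1 y.1 in
  if sort leq_key [seq (bmx_key M, M) | M <- s] is x :: s' then
    [seq p.2 | p <- dedup x s']
  else [::].

Fixpoint reps (ls : seq bool) k : seq bmx :=
  if k is k'.+1 then
    undup_sort [seq reduce (swaps k) N | N <- flatten [seq extensions ls M | M <- reps ls k']]
  else [:: [::]].

Lemma mem_undup_sort s : undup_sort s =i s.
Proof.
have md (T : eqType) x (r : seq T) : dedup x r =i x :: r.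
  elim: r x => //= y r IH x z; case: eqP => [->|_]; rewrite ?IH !inE ?IH ?inE //.
  by rewrite orbA orbb.
move=> M; rewrite /undup_sort; set leq_key := fun _ _ => _.
have -> : (M \in s) = (M \in [seq p.2 | p <- sort leq_key [seq (bmx_key N, N) | N <- s]]).
  apply/idP/mapP => [Ms|[p]]; last by rewrite mem_sort => /mapP[N Ns ->] ->.
  by exists (bmx_key M, M); rewrite // mem_sort; apply: map_f.
by case: (sort _ _) => // x r; apply: eq_mem_map; apply: md.
Qed.

Lemma mem_bitseqs s : s \in bitseqs (size s).
Proof.
elim: s => //= b s IH; rewrite mem_cat.
by case: b; rewrite (map_f (cons _) IH) ?orbT.
Qed.

(** * Every tuple is represented in the enumeration *)

Section Cover.
Variables (V : eqType) (e : V -> V -> bool) (ls : seq bool).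
Hypothesis e_sym : symmetric e.
Hypothesis e_ls : forall x, e x x \in ls.

Definition mat (t : seq V) : bmx := [seq [seq e x y | y <- t] | x <- t].

Lemma mat_rcons t w : mat (rcons t w) = extend (mat t) [seq e w y | y <- t] (e w w).
Proof.
rewrite /mat /extend !map_rcons; congr (rcons _ _).
have Z s : zip [seq [seq e x y | y <- t] | x <- s] [seq e w y | y <- s] =
           [seq ([seq e x y | y <- t], e w x) | x <- s].
  by elim: s => //= x s ->.
by rewrite Z -map_comp; apply: eq_map => x; rewrite /= map_rcons e_sym.
Qed.

Lemma relabel_mat p t : perm_eq p (iota 0 (size t)) ->
  exists2 t', perm_eq t t' & relabel p (mat t) = mat t'.
Proof.
move=> pt; have [Et|[x0 x0t]] : t = [::] \/ exists x0, x0 \in t.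
- by case: (t) => [|x t1]; [left | right; exists x; rewrite inE eqxx].
- by exists [::]; move: pt; rewrite Et // => /perm_nilP->.
exists [seq nth x0 t i | i <- p].
  rewrite perm_sym (perm_trans (perm_map _ pt)) //.
  by rewrite (map_nth_iota0 x0 (leqnn _)) take_size.
have ltp i : i \in p -> (i < size t)%N by rewrite (perm_mem pt) mem_iota.
rewrite /relabel /mat -!map_comp; apply/eq_in_map => i /ltp it /=.
rewrite (nth_map x0) // -map_comp; apply/eq_in_map => j /ltp jt /=.
by rewrite (nth_map x0).
Qed.

Lemma reduce_mat ps t : all (perm_eq^~ (iota 0 (size t))) ps ->
  exists2 t', perm_eq t t' & reduce ps (mat t) = mat t'.
Proof.
rewrite /reduce; move: (bmx_key _) => k0; elim: ps t k0 => [|p ps IH] t k0 /=.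
  by exists t.
case/andP=> pt pst; case: ifP => _; first exact: IH.
have [t' tt' ->] := relabel_mat pt.
have [|t'' t't'' ->] := IH t' (bmx_key (mat t')); first by rewrite -(perm_size tt').
by exists t'' => //; apply: perm_trans t't''.
Qed.

Lemma exists_max (T : eqType) (f : T -> nat) x (s : seq T) :
  exists2 w, w \in x :: s & {in x :: s, forall y, f y <= f w}%N.
Proof.
elim: s x => [|y s IH] x; first by exists x => [|z]; rewrite ?inE // => /eqP->.
have [w ws wmax] := IH y; case: (leqP (f x) (f w)) => xw.
  exists w => [|z]; first by rewrite inE ws orbT.
  by rewrite inE => /orP[/eqP->//|/wmax].
exists x => [|z]; first by rewrite inE eqxx.
by rewrite inE => /orP[/eqP->//|/wmax zw]; apply: leq_trans zw (ltnW xw).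
Qed.

(** Induction on the size, deleting an entry [w] of maximal degree. The rest has a representative,
    adding [w] back gives an extension that passes [last_max], and [reduce] only reorders the tuple.
    The hypothesis on [swaps] is left to be settled by computation for the few sizes needed. *)
Lemma mem_reps t :
  (forall k, k <= size t -> all (perm_eq^~ (iota 0 k)) (swaps k))%N ->
  exists2 t', perm_eq t t' & mat t' \in reps ls (size t).
Proof.
move En: (size t) => n; elim: n t En => [|n IH] t En Hsw.
  by exists t => //; rewrite (size0nil En).
case: t En => // x0 t1 En; set t := x0 :: t1 in En *.
pose f x := count (e x) t.
have [w wt wmax] := exists_max f x0 t1.
have ptr := perm_to_rem wt.
have sr : size (rem w t) = n by rewrite size_rem // En.
have [|t0 rt0 mt0] := IH _ sr; first by move=> k kn; apply: Hsw; apply: leqW.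
(* [w] is placed last because [extend] adds the new vertex at the end. *)
have tt0 : perm_eq t (rcons t0 w).
  by rewrite (perm_trans ptr) // perm_sym perm_rcons perm_cons perm_sym.
have [|t' t0t' Et'] := @reduce_mat (swaps n.+1) (rcons t0 w).
  by rewrite -(perm_size tt0) En; apply: Hsw.
exists t'; first exact: perm_trans t0t'.
rewrite mem_undup_sort -Et'; apply: map_f; apply/flattenP.
exists (extensions ls (mat t0)); first exact: map_f.
rewrite mem_filter; apply/andP; split.
  rewrite /last_max /mat map_rcons last_rcons -map_rcons all_map; apply/allP => x xt /=.
  rewrite !count_map -!(permP tt0).
  by apply: wmax; rewrite (perm_mem tt0).
rewrite mat_rcons; apply/allpairsP; exists ([seq e w y | y <- t0], e w w); split=> //=.
by rewrite size_map -(size_map (e w)) mem_bitseqs.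
Qed.

End Cover.

(** * Soundness of the finite check *)

(** A vertex carries its row, so that [madj] looks up an entry without first searching for the
    row. *)
Definition mvertex (M : bmx) (i : nat) : seq bool * nat := (nth [::] M i, i).

Definition madj (p q : seq bool * nat) : bool := nth false p.1 q.2.

(** [crit] looks at the loops only and selects the graphs whose value must be strictly negative; the
    others need only be nonpositive. *)
Definition check (crit : seq bool -> bool) a b c ls K kap Q D D' : bool :=
  all (fun M => let s := [seq mvertex M i | i <- iota 0 K] in
         let v := value madj a b c K kap Q D D' s in
         if crit [seq madj p p | p <- s] then Z.ltb v 0 else Z.leb v 0)
    (reps ls K).

Section Sound.
Variables (V : finType) (e : V -> V -> bool) (ls : seq bool) (a b c : Z).
Hypothesis e_sym : symmetric e.
Hypothesis e_ls : forall x, e x x \in ls.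
Hypothesis degP : forall x, c * #|[set y | e x y != e x x]|%:R <= a * #|V|%:R.
Hypothesis cdgP : forall x y, e x y = e x x ->
  b * #|V|%:R <= c * #|[set z | (e x z != e x x) && (e y z != e x x)]|%:R.

Lemma value_mat Kp kap Q D D' t :
  value madj a b c Kp kap Q D D' [seq mvertex (mat e t) i | i <- iota 0 (size t)] =
  value e a b c Kp kap Q D D' t.
Proof.
rewrite -(@value_map _ _ _ (mrel (mat e t))) //.
(* Reading entries of [t] by index needs a default element, which [V] need not provide. In
   [option V] an index out of range becomes [None], whose relation to everything is [false], just as
   the defaults of the matrix lookups. *)
pose eo (x y : option V) := if x is Some x' then if y is Some y' then e x' y' else false else false.
rewrite (@value_map _ _ (@Some V) e eo) //.
rewrite (@value_map _ _ (onth t) _ eo); last first.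
  move=> i j; rewrite /mrel /mat; case: (ltnP i (size t)) => it; last first.
    by rewrite onth_default // [nth [::] _ i]nth_default ?size_map // nth_nil.
  case: t it => // x0 t it; rewrite (nth_map x0) // !onthE.
  case: (ltnP j (size (x0 :: t))) => jt; last first.
    rewrite [in LHS]nth_default ?size_map // [nth _ _ j]nth_default ?size_map //.
    by case: (nth _ _ i).
  by rewrite !(nth_map x0).
suff -> : [seq onth t i | i <- iota 0 (size t)] = map (@Some V) t by [].
rewrite -[RHS]take_size -(map_nth_iota0 None (leqnn _)) size_map.
by apply: eq_map => i; rewrite onthE.
Qed.

Lemma mat_diag t :
  [seq madj p p | p <- [seq mvertex (mat e t) i | i <- iota 0 (size t)]] = [seq e x x | x <- t].
Proof.
rewrite -map_comp.
apply: (@eq_from_nth _ false) => [|i]; rewrite !size_map size_iota // => it.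
rewrite (nth_map 0%N) ?size_iota // nth_iota // add0n /= /madj /mat.
case: t it => // x0 t1; move: (x0 :: t1) => t it.
by rewrite /mvertex /= !(nth_map x0).
Qed.

Lemma sumV_lt0 k (G : seq V -> Z) t : (forall s, size s = k -> G s <= 0) ->
  size t = k -> G t < 0 -> sumV k G < 0.
Proof.
move=> G0; elim: k t G G0 => [|k IH] [|x t] G G0 //= [tk] Gt.
rewrite (bigD1 x) //= ltr_wnDr //; last first.
  by apply: (IH t) => // s sk; apply: G0; rewrite /= sk.
apply: sumr_le0 => y _; rewrite -oppr_ge0 -mulN1r -sumVMl; apply: sumV_ge0 => s sk.
by rewrite mulN1r oppr_ge0; apply: G0; rewrite /= sk.
Qed.

(** If [crit] held at [t], the sum over all tuples would have nonpositive terms and a negative one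
    at [t], against [value_ge0]. Hence a successful check forbids every tuple satisfying [crit]. *)
Lemma check_sound (crit : seq bool -> bool) K C t : (0 < K)%N -> size t = K ->
  (forall s s', perm_eq s s' -> crit s = crit s') ->
  cert_ok K C ->
  (forall k, k <= K -> all (perm_eq^~ (iota 0 k)) (swaps k))%N ->
  check crit a b c ls K (kappa C) (grams C) (degs C) (cdgs C) ->
  crit [seq e x x | x <- t] = false.
Proof.
move=> K0 tK critP okC Hsw /allP chk.
pose v s := value e a b c K (kappa C) (grams C) (degs C) (cdgs C) s.
(* The value of [s] is that of a reordering whose matrix is in the list, and [crit] does not see the
   order either. *)
have main s : size s = K -> if crit [seq e x x | x <- s] then v s < 0 else v s <= 0.
  move=> sK; have [|s' ss' ms'] := @mem_reps _ e ls e_sym e_ls s.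
    by rewrite sK.
  have s'K : size s' = K by rewrite -(perm_size ss').
  rewrite sK in ms'; have := chk _ ms'; rewrite -{1}s'K; cbv zeta; rewrite mat_diag value_mat.
  rewrite -(critP _ _ (perm_map (fun x => e x x) ss')) /v -(value_perm _ _ _ _ _ _ _ _ _ ss').
  by case: ifP => _ /= H; lia.
apply/negbTE/negP => ct.
have := value_ge0 degP cdgP K0 okC; rewrite leNgt => /negP; apply.
apply: (sumV_lt0 _ tK); last by have := main t tK; rewrite ct.
by move=> s /main; case: ifP => // _ /ltW.
Qed.

End Sound.

(** * The certificates *)

(* The binary digits of a key, from the lowest and without the leading 1, are the
   path to its leaf. *)
Fixpoint insert A (p : positive) (a : A) (T : trie A) : trie A :=
  let: (l, r) := if T is Node l r then (l, r) else (Nil, Nil) in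
  match p with
  | xH => Leaf a
  | xI p' => Node l (insert p' a r)
  | xO p' => Node (insert p' a l) r
  end.

Definition build A (s : seq (Z * A)) : trie A :=
  foldr (fun p T => insert (Z.to_pos p.1) p.2 T) Nil s.

Definition build2 A (s : seq (Z * seq (Z * A))) : trie (trie A) :=
  build [seq (p.1, build p.2) | p <- s].

Section Data.
Local Open Scope Z_scope.

(** Both types have two roots with loops of opposite colours; the keys 10 and 14 differ in the
    colour of the edge between the roots. Exchanging the two colours and the two roots carries one
    type to the other, and the vectors accordingly. *)
Definition cert4_sq2 : seq (Z * seq (Z * seq Z)) := [::
  (10, [::
    (8, [:: -315; -194; 242]); (12, [:: -33; 683; -147]); (10, [:: -87; -388; -61]);
    (14, [:: 775; -48; -55]); (9, [:: 159; 187; 139]); (13, [:: 96; 82; 156]);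
    (11, [:: -655; 41; -132]); (15, [:: 90; -516; -169])]);
  (14, [::
    (8, [:: 90; -516; -169]); (12, [:: 96; 82; 156]); (10, [:: -655; 41; -132]);
    (14, [:: 159; 187; 139]); (9, [:: 775; -48; -55]); (13, [:: -33; 683; -147]);
    (11, [:: -87; -388; -61]); (15, [:: -315; -194; 242])])].

Definition cert4_deg : seq (Z * Z) := [::
  (72, 547); (76, 5449); (108, 1377); (124, 414); (94, 2728); (126, 3902); (65, 3902);
  (97, 2728); (73, 414); (77, 1377); (109, 5449); (125, 547)].

Definition cert4_cdg : seq (Z * Z) := [::
  (66, 12819); (104, 1476); (98, 30929); (88, 1476); (114, 2); (74, 7321); (106, 4199);
  (90, 38152); (122, 14755); (69, 14755); (85, 4199); (101, 38152); (117, 7321); (77, 2);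
  (103, 1476); (93, 30929); (87, 1476); (125, 12819)].

Definition cert4 := Cert 100 [:: (2%N, 1%N, build2 cert4_sq2)]
  (build cert4_deg) (build cert4_cdg).

(** Each type is a labelled loopless graph on five vertices, and each flag adds one vertex, given by
    its neighbours among the roots. The loop bit comes first in a row and is 0, so all keys of flags
    are even. Each coordinate of the vectors is one linear combination of flags to be squared. *)
Definition cert7_sq5 : seq (Z * seq (Z * seq Z)) := [::
  (32772, [::
    (66, [:: -29]); (68, [:: 29]); (74, [:: 100]); (76, [:: -100]); (82, [:: 100]);
    (84, [:: -100]); (90, [:: -87]); (92, [:: 87]); (98, [:: 100]); (100, [:: -100]);
    (106, [:: -87]); (108, [:: 87]); (114, [:: -87]); (116, [:: 87]); (122, [:: 59]);
    (124, [:: -59])]);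
  (32820, [::
    (64, [:: 0; -167; 0; 35; 0; 0]); (66, [:: 0; -48; 0; 35; -32; -22]);
    (68, [:: 0; -48; 0; 35; -3; 39]); (70, [:: 0; 22; 0; -46; -43; 21]);
    (72, [:: 0; -48; 0; 35; 35; -17]); (74, [:: 0; 22; 0; -46; 4; -48]);
    (76, [:: 0; 22; 0; -46; 40; 27]); (78, [:: 0; 243; 0; 36; 0; 0]);
    (80, [:: -80; -218; 64; -27; 0; 0]); (82, [:: 619; -60; 48; 8; -89; -61]);
    (84, [:: 619; -60; 48; 8; -8; 108]); (86, [:: 331; 98; -37; 39; -70; 34]);
    (88, [:: 619; -60; 48; 8; 97; -47]); (90, [:: 331; 98; -37; 39; 6; -77]);
    (92, [:: 331; 98; -37; 39; 64; 44]); (94, [:: 173; 154; -277; -42; 0; 0]);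
    (96, [:: 80; -218; -64; -27; 0; 0]); (98, [:: -619; -60; -48; 8; -89; -61]);
    (100, [:: -619; -60; -48; 8; -8; 108]); (102, [:: -331; 98; 37; 39; -70; 34]);
    (104, [:: -619; -60; -48; 8; 97; -47]); (106, [:: -331; 98; 37; 39; 6; -77]);
    (108, [:: -331; 98; 37; 39; 64; 44]); (110, [:: -173; 154; 277; -42; 0; 0]);
    (112, [:: 0; -244; 0; -39; 0; 0]); (114, [:: 0; -65; 0; 19; -51; -35]);
    (116, [:: 0; -65; 0; 19; -5; 62]); (118, [:: 0; 98; 0; -36; -88; 42]);
    (120, [:: 0; -65; 0; 19; 56; -27]); (122, [:: 0; 98; 0; -36; 7; -97]);
    (124, [:: 0; 98; 0; -36; 81; 55]); (126, [:: 0; 260; 0; -35; 0; 0])]);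
  (33284, [::
    (64, [:: 0; 0; 0; 118; 0; 17; 0; 0; 0]); (66, [:: 189; -45; 43; -98; 57; -1; 17; 22; -19]);
    (72, [:: -189; 43; 45; -98; -57; -1; 22; -17; 19]);
    (74, [:: 0; -2; 75; -89; 0; 3; 36; 5; 0]);
    (80, [:: -189; -43; -45; -98; -57; -1; -22; 17; 19]);
    (82, [:: 0; -75; -2; -89; 0; 3; -5; 36; 0]); (88, [:: -19; 0; 0; -225; 299; -99; 0; 0; 27]);
    (90, [:: -256; 477; -448; -98; 2; 40; -2; -2; 19]);
    (68, [:: 189; 45; -43; -98; 57; -1; -17; -22; -19]);
    (70, [:: 19; 0; 0; -225; -299; -99; 0; 0; -27]); (76, [:: 0; 75; 2; -89; 0; 3; 5; -36; 0]);
    (78, [:: 256; -448; -477; -98; -2; 40; -2; 2; -19]);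
    (84, [:: 0; 2; -75; -89; 0; 3; -36; -5; 0]);
    (86, [:: 256; 448; 477; -98; -2; 40; 2; -2; -19]);
    (92, [:: -256; -477; 448; -98; 2; 40; 2; 2; 19]); (94, [:: 0; 0; 0; -160; 0; 69; 0; 0; 0]);
    (96, [:: 0; 0; 0; 158; 0; 1; 0; 0; 0]);
    (98, [:: 157; -73; 69; 216; -64; -108; 18; 24; -14]);
    (104, [:: -157; 69; 73; 216; 64; -108; 24; -18; 14]);
    (106, [:: 0; 14; -465; 47; 0; -43; 16; 2; 0]);
    (112, [:: -157; -69; -73; 216; 64; -108; -24; 18; 14]);
    (114, [:: 0; 465; 14; 47; 0; -43; -2; 16; 0]);
    (120, [:: 856; 0; 0; 209; -70; 168; 0; 0; 43]);
    (122, [:: -315; 74; -69; -46; -104; -11; 12; 16; 24]);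
    (100, [:: 157; 73; -69; 216; -64; -108; -18; -24; -14]);
    (102, [:: -856; 0; 0; 209; 70; 168; 0; 0; -43]);
    (108, [:: 0; -465; -14; 47; 0; -43; 2; -16; 0]);
    (110, [:: 315; -69; -74; -46; 104; -11; 16; -12; -24]);
    (116, [:: 0; -14; 465; 47; 0; -43; -16; -2; 0]);
    (118, [:: 315; 69; 74; -46; 104; -11; -16; 12; -24]);
    (124, [:: -315; -74; 69; -46; -104; -11; -12; -16; 24]);
    (126, [:: 0; 0; 0; 101; 0; 94; 0; 0; 0])]);
  (33044, [::
    (64, [:: -20; 0; 0; 20; 2]); (66, [:: -9; 38; 20; -14; 5]); (68, [:: -9; -38; -20; -14; 5]);
    (70, [:: -60; 0; 0; -43; 7]); (80, [:: 93; -23; 34; 26; -6]);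
    (82, [:: -24; 15; 55; -5; -5]); (84, [:: -115; -69; 14; 3; -6]);
    (86, [:: -180; -27; 35; -26; -5]); (72, [:: 93; 23; -34; 26; -6]);
    (74, [:: -115; 69; -14; 3; -6]); (76, [:: -24; -15; -55; -5; -5]);
    (78, [:: -180; 27; -35; -26; -5]); (88, [:: -93; 0; 0; 43; -17]);
    (90, [:: -22; 37; 21; 4; -15]); (92, [:: -22; -37; -21; 4; -15]);
    (94, [:: 443; 0; 0; -72; -25]); (96, [:: 317; 0; 0; 22; 20]); (98, [:: 4; 39; 24; -7; 15]);
    (100, [:: 4; -39; -24; -7; 15]); (102, [:: -146; 0; 0; -35; 14]);
    (112, [:: 5; -25; 35; 37; 3]); (114, [:: 82; 12; 58; -1; 5]); (116, [:: 8; -60; 9; 4; 6]);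
    (118, [:: 89; -25; 34; -35; 6]); (104, [:: 5; 25; -35; 37; 3]); (106, [:: 8; 60; -9; 4; 6]);
    (108, [:: 82; -12; -58; -1; 5]); (110, [:: 89; 25; -34; -35; 6]);
    (120, [:: 282; 0; 0; 35; -2]); (122, [:: 23; 38; 24; 9; -5]);
    (124, [:: 23; -38; -24; 9; -5]); (126, [:: -199; 0; 0; -19; -7])]);
  (32948, [::
    (64, [:: -45; -286; 0; 376; 0; -130; 0; -60; 26; -17]);
    (66, [:: -132; 140; 0; 83; 0; -152; 0; 22; -11; -10]);
    (68, [:: 443; 120; 509; 188; -174; 64; -107; 0; 6; -4]);
    (70, [:: -250; 175; -209; -27; -46; -61; -82; 52; 4; -7]);
    (72, [:: 443; 120; -509; 188; 174; 64; 107; 0; 6; -4]);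
    (74, [:: -250; 175; 209; -27; 46; -61; 82; 52; 4; -7]);
    (76, [:: 498; -740; 0; 10; 0; 116; 0; -3; 24; 2]);
    (78, [:: -657; -192; 0; 212; 0; 116; 0; -36; 32; 26]);
    (80, [:: -178; 841; 0; 128; 0; 45; 0; -47; -21; -23]);
    (82, [:: 642; -170; 0; -470; 0; -95; 0; 3; -56; -5]);
    (84, [:: 86; -281; 91; -191; -65; 13; -96; -62; 14; -15]);
    (86, [:: -55; 314; 304; -47; 713; 15; -67; -27; -37; 37]);
    (88, [:: 86; -281; -91; -191; 65; 13; 96; -62; 14; -15]);
    (90, [:: -55; 314; -304; -47; -713; 15; 67; -27; -37; 37]);
    (92, [:: -49; 544; 0; -254; 0; 194; 0; -8; 6; -8]);
    (94, [:: 391; 797; 0; -138; 0; -178; 0; -9; 64; 39]);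
    (96, [:: 436; -21; 0; 104; 0; 10; 0; 71; -13; -58]);
    (98, [:: 381; 241; 0; 244; 0; -39; 0; 32; -30; 17]);
    (100, [:: 1117; -41; -1036; 157; 84; 45; -76; 23; -4; 15]);
    (102, [:: -368; -307; -41; 211; -95; 5; -101; 34; -13; 20]);
    (104, [:: 1117; -41; 1036; 157; -84; 45; 76; 23; -4; 15]);
    (106, [:: -368; -307; 41; 211; 95; 5; 101; 34; -13; 20]);
    (108, [:: 750; 171; 0; -62; 0; 56; 0; 73; 16; 6]);
    (110, [:: -401; -657; 0; -17; 0; 56; 0; 57; -10; 30]);
    (112, [:: -56; 204; 0; 230; 0; 91; 0; -62; -42; -10]);
    (114, [:: 14; -880; 0; -123; 0; -113; 0; -52; -25; 11]);
    (116, [:: 952; 36; 388; -255; -134; 19; -109; -16; -2; 7]);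
    (118, [:: -932; 302; -262; -73; -12; 22; -97; 7; -11; 6]);
    (120, [:: 952; 36; -388; -255; 134; 19; 109; -16; -2; 7]);
    (122, [:: -932; 302; 262; -73; 12; 22; 97; 7; -11; 6]);
    (124, [:: 11; -41; 0; -227; 0; 89; 0; 1; 19; 8]);
    (126, [:: -1103; -179; 0; -406; 0; 39; 0; 53; 11; -7])]);
  (49172, [::
    (64, [:: 0; 105; 0; 0; 0; 0; -29; 0; 16; 0; 4]);
    (66, [:: 0; -246; 0; 0; 0; 0; 243; 0; -6; 0; 16]);
    (80, [:: 0; 95; 0; 0; 199; 0; -84; -22; 42; 0; 3]);
    (82, [:: 0; -54; 0; 0; 337; 0; 89; -25; 13; 0; 22]);
    (96, [:: 0; 95; 0; 0; -199; 0; -84; 22; 42; 0; 3]);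
    (98, [:: 0; -54; 0; 0; -337; 0; 89; 25; 13; 0; 22]);
    (112, [:: 0; 38; 0; 0; 0; 0; -574; 0; 32; 0; 13]);
    (114, [:: 0; 301; 0; 0; 0; 0; -30; 0; 32; 0; 27]);
    (68, [:: 341; -593; 0; 584; 0; -312; 141; 0; 50; -69; -6]);
    (70, [:: 308; -418; 0; -294; 0; -545; 206; 0; 8; 20; 12]);
    (84, [:: 315; -71; -381; 654; 625; -132; -47; -26; 24; 45; -11]);
    (86, [:: 1129; 287; -1030; 102; -700; 103; 28; -26; -38; -27; 12]);
    (100, [:: 315; -71; 381; 654; -625; -132; -47; 26; 24; 45; -11]);
    (102, [:: 1129; 287; 1030; 102; 700; 103; 28; 26; -38; -27; 12]);
    (116, [:: 882; 1242; 0; -946; 0; -164; 195; 0; 41; 11; -18]);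
    (118, [:: 1135; 309; 0; 74; 0; 238; -108; 0; -20; 36; 12]);
    (72, [:: -341; -593; 0; -584; 0; 312; 141; 0; 50; 69; -6]);
    (74, [:: -308; -418; 0; 294; 0; 545; 206; 0; 8; -20; 12]);
    (88, [:: -315; -71; 381; -654; 625; 132; -47; -26; 24; -45; -11]);
    (90, [:: -1129; 287; 1030; -102; -700; -103; 28; -26; -38; 27; 12]);
    (104, [:: -315; -71; -381; -654; -625; 132; -47; 26; 24; -45; -11]);
    (106, [:: -1129; 287; -1030; -102; 700; -103; 28; 26; -38; 27; 12]);
    (120, [:: -882; 1242; 0; 946; 0; 164; 195; 0; 41; -11; -18]);
    (122, [:: -1135; 309; 0; -74; 0; -238; -108; 0; -20; -36; 12]);
    (76, [:: 0; 160; 0; 0; 0; 0; 125; 0; -8; 0; -6]);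
    (78, [:: 0; -229; 0; 0; 0; 0; 124; 0; -85; 0; -24]);
    (92, [:: 0; -112; 0; 0; -269; 0; -16; -24; 0; 0; -22]);
    (94, [:: 0; -36; 0; 0; -109; 0; 54; -27; -47; 0; -3]);
    (108, [:: 0; -112; 0; 0; 269; 0; -16; 24; 0; 0; -22]);
    (110, [:: 0; -36; 0; 0; 109; 0; 54; 27; -47; 0; -3]);
    (124, [:: 0; -353; 0; 0; 0; 0; -145; 0; 0; 0; -38]);
    (126, [:: 0; 237; 0; 0; 0; 0; -205; 0; -69; 0; -10])]);
  (37012, [::
    (64, [:: 0; 2; 7]); (66, [:: 0; -15; 5]); (68, [:: 0; 17; -9]); (70, [:: 0; 0; -12]);
    (96, [:: 0; 7; 30]); (98, [:: 0; -10; 25]); (100, [:: 0; 23; 16]); (102, [:: 0; 5; 8]);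
    (72, [:: 366; -1; -2]); (74, [:: 404; -18; -4]); (76, [:: 373; 13; -18]);
    (78, [:: 385; -4; -21]); (104, [:: 312; 3; 21]); (106, [:: 319; -14; 16]);
    (108, [:: 339; 18; 4]); (110, [:: 305; 1; -1]); (80, [:: -366; -1; -2]);
    (82, [:: -404; -18; -4]); (84, [:: -373; 13; -18]); (86, [:: -385; -4; -21]);
    (112, [:: -312; 3; 21]); (114, [:: -319; -14; 16]); (116, [:: -339; 18; 4]);
    (118, [:: -305; 1; -1]); (88, [:: 0; -5; -10]); (90, [:: 0; -22; -14]);
    (92, [:: 0; 9; -28]); (94, [:: 0; -7; -31]); (120, [:: 0; 0; 13]); (122, [:: 0; -18; 7]);
    (124, [:: 0; 14; -4]); (126, [:: 0; -3; -9])]);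
  (34996, [::
    (64, [:: 0; 240; 0; -10]); (66, [:: 0; 211; 0; 7]); (68, [:: -312; 53; 31; -12]);
    (70, [:: -86; 17; 53; 5]); (72, [:: 312; 53; -31; -12]); (74, [:: 86; 17; -53; 5]);
    (76, [:: 0; -129; 0; -15]); (78, [:: 0; -192; 0; 0]); (80, [:: 0; 179; 0; -5]);
    (82, [:: 0; 146; 0; 12]); (84, [:: 95; -4; 72; -8]); (86, [:: -316; -41; 30; 10]);
    (88, [:: -95; -4; -72; -8]); (90, [:: 316; -41; -30; 10]); (92, [:: 0; -193; 0; -10]);
    (94, [:: 0; -181; 0; 5]); (96, [:: 0; 179; 0; -5]); (98, [:: 0; 146; 0; 12]);
    (100, [:: 95; -4; 72; -8]); (102, [:: -316; -41; 30; 10]); (104, [:: -95; -4; -72; -8]);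
    (106, [:: 316; -41; -30; 10]); (108, [:: 0; -193; 0; -10]); (110, [:: 0; -181; 0; 5]);
    (112, [:: 0; 141; 0; 0]); (114, [:: 0; 86; 0; 17]); (116, [:: -141; -63; 48; -3]);
    (118, [:: 288; -98; 91; 14]); (120, [:: 141; -63; -48; -3]); (122, [:: -288; -98; -91; 14]);
    (124, [:: 0; -247; 0; -5]); (126, [:: 0; -250; 0; 10])]);
  (33556, [::
    (66, [:: 14; 30]); (80, [:: -14; -30]); (68, [:: 30; -14]); (70, [:: 42; 16]);
    (84, [:: 16; -42]); (86, [:: 28; -13]); (72, [:: -30; 14]); (74, [:: -16; 42]);
    (88, [:: -42; -16]); (90, [:: -28; 13]); (78, [:: 13; 28]); (92, [:: -13; -28]);
    (98, [:: 14; 31]); (112, [:: -14; -31]); (100, [:: 31; -14]); (102, [:: 45; 17]);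
    (116, [:: 17; -45]); (118, [:: 31; -14]); (104, [:: -31; 14]); (106, [:: -17; 45]);
    (120, [:: -45; -17]); (122, [:: -31; 14]); (110, [:: 14; 31]); (124, [:: -14; -31])]);
  (33204, [::
    (64, [:: 0; -129; 0; -116; 0; 0; 241; 134; 0; 38; 0; 0; 0; 1]);
    (66, [:: 241; 158; 0; -89; 0; 0; -17; 43; 0; 27; 0; 0; -53; -1]);
    (68, [:: -241; 158; 0; -89; 0; 0; -17; 43; 0; 27; 0; 0; 53; -1]);
    (70, [:: 0; 18; 0; 132; 0; 0; 61; -96; 0; -11; 0; 0; 0; -9]);
    (72, [:: 0; -816; 532; 108; 0; -134; -193; 63; 82; 32; 0; -9; 0; 4]);
    (74, [:: -208; 116; -377; 401; 15; 321; 135; -75; 81; 2; -100; 21; -40; 17]);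
    (76, [:: 208; 116; -377; 401; -15; 321; 135; -75; 81; 2; 100; 21; 40; 17]);
    (78, [:: 0; -505; -805; 79; 0; 172; 357; 38; -11; -83; 0; -18; 0; -18]);
    (80, [:: 0; -816; -532; 108; 0; 134; -193; 63; -82; 32; 0; 9; 0; 4]);
    (82, [:: -208; 116; 377; 401; -15; -321; 135; -75; -81; 2; 100; -21; -40; 17]);
    (84, [:: 208; 116; 377; 401; 15; -321; 135; -75; -81; 2; -100; -21; 40; 17]);
    (86, [:: 0; -505; 805; 79; 0; -172; 357; 38; 11; -83; 0; 18; 0; -18]);
    (88, [:: 0; -55; 0; -382; 0; 0; 41; 164; 0; -31; 0; 0; 0; 25]);
    (90, [:: -6; -204; 0; -358; 0; 0; -179; 17; 0; -40; 0; 0; -24; 17]);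
    (92, [:: 6; -204; 0; -358; 0; 0; -179; 17; 0; -40; 0; 0; 24; 17]);
    (94, [:: 0; -90; 0; 204; 0; 0; -383; -188; 0; 14; 0; 0; 0; 14]);
    (96, [:: 0; 383; 0; 302; 0; 0; -144; 412; 0; 59; 0; 0; 0; -18]);
    (98, [:: -58; 84; 0; 202; 0; 0; 139; -112; 0; 52; 0; 0; -58; -10]);
    (100, [:: 58; 84; 0; 202; 0; 0; 139; -112; 0; 52; 0; 0; 58; -10]);
    (102, [:: 0; -134; 0; 120; 0; 0; -5; -236; 0; 23; 0; 0; 0; -26]);
    (104, [:: 0; -347; -598; -809; 0; -187; 284; -82; 37; 42; 0; -47; 0; 2]);
    (106, [:: -1120; 642; -335; -91; 753; -624; 215; 14; 14; -8; 2; 19; 8; 1]);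
    (108, [:: 1120; 642; -335; -91; -753; -624; 215; 14; 14; -8; -2; 19; -8; 1]);
    (110, [:: 0; 770; 458; -379; 0; -171; -273; -63; 86; -18; 0; -20; 0; -4]);
    (112, [:: 0; -347; 598; -809; 0; 187; 284; -82; -37; 42; 0; 47; 0; 2]);
    (114, [:: -1120; 642; 335; -91; -753; 624; 215; 14; -14; -8; -2; -19; 8; 1]);
    (116, [:: 1120; 642; 335; -91; 753; 624; 215; 14; -14; -8; 2; -19; -8; 1]);
    (118, [:: 0; 770; -458; -379; 0; 171; -273; -63; -86; -18; 0; 20; 0; -4]);
    (120, [:: 0; 176; 0; 390; 0; 0; 123; 81; 0; -23; 0; 0; 0; 13]);
    (122, [:: -270; -21; 0; 228; 0; 0; -84; -24; 0; -36; 0; 0; -36; -2]);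
    (124, [:: 270; -21; 0; 228; 0; 0; -84; -24; 0; -36; 0; 0; 36; -2]);
    (126, [:: 0; 35; 0; -129; 0; 0; -464; -36; 0; -41; 0; 0; 0; -23])]);
  (41236, [::
    (64, [:: -93; 0; 0; -56; 73; 0; 0; 0; 24; 17; 0; 18]);
    (68, [:: -188; -539; 637; -236; 153; -447; 91; -41; -1; -10; 45; 13]);
    (72, [:: -188; 539; -637; -236; 153; 447; -91; 41; -1; -10; -45; 13]);
    (76, [:: 273; 0; 0; -402; 575; 0; 0; 0; -15; -19; 0; 6]);
    (66, [:: -327; 0; 0; -205; -597; 0; 0; 0; -16; 6; 0; 17]);
    (70, [:: 946; 90; -437; -765; -190; -614; 311; -14; -20; -17; 3; 5]);
    (74, [:: 946; -90; 437; -765; -190; 614; -311; 14; -20; -17; -3; 5]);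
    (78, [:: 1697; 0; 0; 385; 260; 0; 0; 0; -54; -17; 0; -10]);
    (96, [:: 535; -297; 83; 1042; 43; 335; -293; -142; 7; 7; 13; 15]);
    (100, [:: -84; -657; -962; 278; 214; -124; 13; -119; 8; -3; -13; 4]);
    (104, [:: -877; 938; -128; 401; -362; 350; 387; -196; 12; -32; 22; 8]);
    (108, [:: -213; 1192; -782; -75; 504; -508; -286; -15; -4; -12; -7; -2]);
    (98, [:: 695; 38; -324; -161; -335; 284; -80; -164; 12; 17; -7; 0]);
    (102, [:: -147; -564; -91; 140; -350; -246; -160; -133; -29; -6; 28; -1]);
    (106, [:: -259; 238; -1016; -164; 145; 351; -16; 194; -10; 50; 54; 6]);
    (110, [:: 131; 518; -105; 135; 276; -145; -104; -96; -31; 13; 17; -9]);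
    (80, [:: 535; 297; -83; 1042; 43; -335; 293; 142; 7; 7; -13; 15]);
    (84, [:: -877; -938; 128; 401; -362; -350; -387; 196; 12; -32; -22; 8]);
    (88, [:: -84; 657; 962; 278; 214; 124; -13; 119; 8; -3; 13; 4]);
    (92, [:: -213; -1192; 782; -75; 504; 508; 286; 15; -4; -12; 7; -2]);
    (82, [:: 695; -38; 324; -161; -335; -284; 80; 164; 12; 17; 7; 0]);
    (86, [:: -259; -238; 1016; -164; 145; -351; 16; -194; -10; 50; -54; 6]);
    (90, [:: -147; 564; 91; 140; -350; 246; 160; 133; -29; -6; -28; -1]);
    (94, [:: 131; -518; 105; 135; 276; 145; 104; 96; -31; 13; -17; -9]);
    (112, [:: 1603; 0; 0; -8; 144; 0; 0; 0; 62; 0; 0; -9]);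
    (116, [:: 11; -1382; 7; -314; 151; -70; -111; 9; 40; -12; 18; -13]);
    (120, [:: 11; 1382; -7; -314; 151; 70; 111; -9; 40; -12; -18; -13]);
    (124, [:: -1286; 0; 0; 583; 374; 0; 0; 0; 3; 0; 0; -13]);
    (114, [:: 863; 0; 0; 50; -373; 0; 0; 0; 22; 14; 0; -16]);
    (118, [:: 241; -1502; -728; 448; -288; 97; 174; -4; -11; -1; -18; -24]);
    (122, [:: 241; 1502; 728; 448; -288; -97; -174; 4; -11; -1; 18; -24]);
    (126, [:: -1960; 0; 0; -510; -139; 0; 0; 0; -6; 9; 0; -22])]);
  (37044, [::
    (64, [:: 844; 199; 0; 0; 11; 19; 0; 32]); (66, [:: -183; 275; -227; 28; 14; 1; 7; 32]);
    (68, [:: -183; 275; 227; -28; 14; 1; -7; 32]); (70, [:: -422; 218; 0; 0; 19; -15; 0; 46]);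
    (72, [:: -55; -142; 0; 0; 0; 24; 0; 28]); (74, [:: -880; -78; -221; 31; 6; 8; 7; 31]);
    (76, [:: -880; -78; 221; -31; 6; 8; -7; 31]); (78, [:: -544; -135; 0; 0; -25; -16; 0; 72]);
    (96, [:: 79; 250; 103; 15; 8; 15; 19; -33]); (98, [:: 193; 144; -93; 44; 27; -2; 24; -10]);
    (100, [:: 320; 163; 300; -23; 8; -1; 14; 2]);
    (102, [:: 849; -30; 131; 18; 23; -21; 17; 20]);
    (104, [:: 459; -248; 66; 7; -24; 18; 22; -2]);
    (106, [:: -150; -252; -75; 50; 13; 3; 23; 0]);
    (108, [:: 160; -74; 106; -59; -52; -1; 31; 42]);
    (110, [:: -87; -437; 432; 97; 79; 3; -13; -39]);
    (80, [:: 79; 250; -103; -15; 8; 15; -19; -33]);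
    (82, [:: 320; 163; -300; 23; 8; -1; -14; 2]);
    (84, [:: 193; 144; 93; -44; 27; -2; -24; -10]);
    (86, [:: 849; -30; -131; -18; 23; -21; -17; 20]);
    (88, [:: 459; -248; -66; -7; -24; 18; -22; -2]);
    (90, [:: 160; -74; -106; 59; -52; -1; -31; 42]);
    (92, [:: -150; -252; 75; -50; 13; 3; -23; 0]);
    (94, [:: -87; -437; -432; -97; 79; 3; 13; -39]);
    (112, [:: -763; 371; 0; 0; -47; 4; 0; -92]);
    (114, [:: 497; 95; -146; 42; -15; -11; 1; -44]);
    (116, [:: 497; 95; 146; -42; -15; -11; -1; -44]);
    (118, [:: -437; 127; 0; 0; 24; -24; 0; -51]); (120, [:: 538; -244; 0; 0; -68; 8; 0; -35]);
    (122, [:: -348; -221; -162; 38; -41; -8; 2; -38]);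
    (124, [:: -348; -221; 162; -38; -41; -8; -2; -38]);
    (126, [:: 73; -304; 0; 0; -32; -26; 0; 1])]);
  (45204, [::
    (64, [:: -125; 0; -4]); (66, [:: -37; 0; -22]); (96, [:: 158; 0; 19]); (98, [:: -98; 0; 6]);
    (68, [:: 368; 38; -2]); (70, [:: -335; 39; -8]); (100, [:: 56; 38; 29]);
    (102, [:: -101; 39; 15]); (72, [:: 368; -38; -2]); (74, [:: -335; -39; -8]);
    (104, [:: 56; -38; 29]); (106, [:: -101; -39; 15]); (76, [:: 7; 0; 13]);
    (78, [:: 15; 0; -4]); (108, [:: 162; 0; 39]); (110, [:: -96; 0; 24]);
    (80, [:: 211; 0; -25]); (82, [:: 51; 0; -42]); (112, [:: 422; 0; -2]);
    (114, [:: -54; 0; -11]); (84, [:: 174; 38; -16]); (86, [:: -100; 40; -28]);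
    (116, [:: -121; 38; 16]); (118, [:: 152; 37; -4]); (88, [:: 174; -38; -16]);
    (90, [:: -100; -40; -28]); (120, [:: -121; -38; 16]); (122, [:: 152; -37; -4]);
    (92, [:: -8; 0; -4]); (94, [:: -371; 0; -14]); (124, [:: 87; 0; 22]);
    (126, [:: -447; 0; 14])]);
  (35252, [::
    (64, [:: 0; 11; 26; -37; 0]); (66, [:: 0; -87; 47; -17; -17]);
    (68, [:: 0; 88; -41; -26; -12]); (70, [:: 0; -11; -18; -8; -30]);
    (72, [:: 179; 66; 43; -18; 8]); (74, [:: 183; -31; 65; 3; -10]);
    (76, [:: 170; 140; -24; -7; -4]); (78, [:: 193; 64; 10; 8; -24]);
    (80, [:: -179; 66; 43; -18; 8]); (82, [:: -183; -31; 65; 3; -10]);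
    (84, [:: -170; 140; -24; -7; -4]); (86, [:: -193; 64; 10; 8; -24]);
    (88, [:: 0; 123; 60; 4; 16]); (90, [:: 0; 27; 83; 22; -2]); (92, [:: 0; 196; -7; 14; 4]);
    (94, [:: 0; 77; 9; 27; -12]); (96, [:: 0; -106; -24; -27; 16]);
    (98, [:: 0; -205; 3; -10; -4]); (100, [:: 0; -27; -87; -16; 2]);
    (102, [:: 0; -122; -64; 4; -16]); (104, [:: 187; -49; -6; -6; 24]);
    (106, [:: 170; -148; 18; 11; 5]); (108, [:: 181; 31; -69; 4; 9]);
    (110, [:: 175; -71; -49; 22; -11]); (112, [:: -187; -49; -6; -6; 24]);
    (114, [:: -170; -148; 18; 11; 5]); (116, [:: -181; 31; -69; 4; 9]);
    (118, [:: -175; -71; -49; 22; -11]); (120, [:: 0; 7; 14; 13; 30]);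
    (122, [:: 0; -90; 36; 32; 12]); (124, [:: 0; 87; -52; 25; 17]);
    (126, [:: 0; -2; -12; 41; 2])]);
  (39348, [::
    (64, [:: 32; 0; 0; 0]); (66, [:: 34; 0; 0; -17]); (68, [:: 34; 0; 0; 17]);
    (70, [:: 44; 0; 0; 0]); (72, [:: -1; 12; -14; 0]); (74, [:: 9; 12; -14; -17]);
    (76, [:: 9; 12; -14; 17]); (78, [:: 16; 11; -13; 0]); (80, [:: -1; -18; -3; 0]);
    (82, [:: 9; -18; -3; -17]); (84, [:: 9; -18; -3; 17]); (86, [:: 16; -17; -3; 0]);
    (88, [:: -23; -6; -17; 0]); (90, [:: -14; -6; -17; -17]); (92, [:: -14; -6; -17; 17]);
    (94, [:: 6; -7; -20; 0]); (96, [:: -1; 6; 17; 0]); (98, [:: 9; 6; 17; -17]);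
    (100, [:: 9; 6; 17; 17]); (102, [:: 16; 6; 16; 0]); (104, [:: -23; 18; 3; 0]);
    (106, [:: -14; 18; 3; -17]); (108, [:: -14; 18; 3; 17]); (110, [:: 6; 21; 4; 0]);
    (112, [:: -23; -12; 14; 0]); (114, [:: -14; -12; 14; -17]); (116, [:: -14; -12; 14; 17]);
    (118, [:: 6; -14; 16; 0]); (120, [:: -47; 0; 0; 0]); (122, [:: -40; 0; 0; -16]);
    (124, [:: -40; 0; 0; 16]); (126, [:: -51; 0; 0; 0])]);
  (33716, [::
    (64, [:: 50; 45; 0; 0; 0; 0; 0; 0; 0; 0]); (66, [:: -54; 6; 38; 56; -60; 3; -1; 0; 0; 0]);
    (68, [:: -54; 6; 1; 38; 82; -1; 2; 2; 0; 0]);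
    (70, [:: 315; 88; -105; -255; -59; -63; -47; -49; -16; 90]);
    (72, [:: -54; 6; -86; -17; -24; -1; 1; -3; 0; 0]);
    (74, [:: 315; 88; 128; -106; 228; -55; -3; 74; -70; -59]);
    (76, [:: 315; 88; 228; -58; -156; 39; -80; 25; 86; -31]);
    (78, [:: -89; 96; 31; -52; 2; 44; 73; -28; 0; 0]);
    (80, [:: -54; 6; 47; -78; 2; -1; -2; 1; 0; 0]);
    (82, [:: 315; 88; -228; 58; 156; -39; 80; -25; 86; -31]);
    (84, [:: 315; 88; -128; 106; -228; 55; 3; -74; -70; -59]);
    (86, [:: -89; 96; -57; -11; -16; 27; -21; 83; 0; 0]);
    (88, [:: 315; 88; 105; 255; 59; 63; 47; 49; -16; 90]);
    (90, [:: -89; 96; 1; 26; 55; 17; -69; -55; 0; 0]);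
    (92, [:: -89; 96; 25; 37; -40; -88; 17; 0; 0; 0]);
    (94, [:: -53; -118; 0; 0; 0; 0; 0; 0; 0; 0]); (96, [:: -21; -37; 0; 0; 0; 0; 0; 0; 0; 0]);
    (98, [:: 57; 68; -25; -36; 39; 79; -15; 0; 0; 0]);
    (100, [:: 57; 68; -1; -25; -53; -16; 62; 49; 0; 0]);
    (102, [:: -33; 153; 48; 117; 27; -102; -75; -79; 9; -52]);
    (104, [:: 57; 68; 56; 11; 16; -24; 18; -75; 0; 0]);
    (106, [:: -33; 153; -59; 49; -104; -89; -6; 120; 41; 34]);
    (108, [:: -33; 153; -105; 27; 71; 63; -129; 41; -50; 18]);
    (110, [:: 137; -202; 10; -17; 1; 8; 12; -5; 0; 0]);
    (112, [:: 57; 68; -30; 50; -2; -40; -65; 25; 0; 0]);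
    (114, [:: -33; 153; 105; -27; -71; -63; 129; -41; -50; 18]);
    (116, [:: -33; 153; 59; -49; 104; 89; 6; -120; 41; 34]);
    (118, [:: 137; -202; -19; -4; -5; 5; -4; 14; 0; 0]);
    (120, [:: -33; 153; -48; -117; -27; 102; 75; 79; 9; -52]);
    (122, [:: 137; -202; 0; 9; 18; 3; -12; -9; 0; 0]);
    (124, [:: 137; -202; 9; 13; -14; -15; 3; 0; 0; 0]);
    (126, [:: -174; 86; 0; 0; 0; 0; 0; 0; 0; 0])]);
  (49204, [::
    (64, [:: -175; 144; 0; 0; 71; 0; 0; 0; 0; 0; -5; 0; 0; 0]);
    (80, [:: -185; -74; 0; 0; -77; 0; 0; 0; 0; -7; -22; 0; 0; 14]);
    (66, [:: 356; -113; 0; 0; -106; -193; -29; 3; 8; 0; 22; -11; -9; 0]);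
    (82, [:: 260; 2; -271; -288; 119; -18; -3; -21; -51; 0; -15; -8; -7; 31]);
    (68, [:: 356; -113; 0; 0; -106; 122; -153; 5; -7; 0; 22; -2; 14; 0]);
    (84, [:: 260; 2; -114; 379; 119; 11; -14; -34; 44; 0; -15; -2; 11; 31]);
    (70, [:: -132; 58; 0; 0; 96; 81; 206; -5; -1; 0; 9; -35; 13; 0]);
    (86, [:: -247; 87; 341; -80; -34; -14; -36; -127; -17; -32; 12; 6; -2; -4]);
    (72, [:: 356; -113; 0; 0; -106; 71; 182; -8; -1; 0; 22; 13; -5; 0]);
    (88, [:: 260; 2; 385; -90; 119; 7; 17; 55; 7; 0; -15; 10; -4; 31]);
    (74, [:: -132; 58; 0; 0; 96; 138; -173; 3; -4; 0; 9; 6; -37; 0]);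
    (90, [:: -247; 87; -101; 335; -34; -24; 30; 78; -101; -32; 12; -1; 6; -4]);
    (76, [:: -132; 58; 0; 0; 96; -219; -33; 2; 5; 0; 9; 29; 24; 0]);
    (92, [:: -247; 87; -240; -255; -34; 38; 6; 49; 119; -32; 12; -5; -4; -4]);
    (78, [:: -267; -306; 0; 0; 55; 0; 0; 0; 0; 0; 23; 0; 0; 0]);
    (94, [:: 223; 361; 0; 0; 123; 0; 0; 0; 0; -15; 30; 0; 0; 20]);
    (96, [:: -185; -74; 0; 0; -77; 0; 0; 0; 0; 7; -22; 0; 0; -14]);
    (112, [:: -220; -161; 0; 0; -41; 0; 0; 0; 0; 0; -30; 0; 0; 0]);
    (98, [:: 260; 2; 271; 288; 119; -18; -3; -21; -51; 0; -15; -8; -7; -31]);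
    (114, [:: 469; 29; 0; 0; -88; 51; 8; -12; -30; 0; -4; -33; -27; 0]);
    (100, [:: 260; 2; 114; -379; 119; 11; -14; -34; 44; 0; -15; -2; 11; -31]);
    (116, [:: 469; 29; 0; 0; -88; -32; 40; -20; 26; 0; -4; -7; 42; 0]);
    (102, [:: -247; 87; -341; 80; -34; -14; -36; -127; -17; 32; 12; 6; -2; 4]);
    (118, [:: -21; 517; 0; 0; -85; -90; -229; 30; 4; 0; -14; -30; 11; 0]);
    (104, [:: 260; 2; -385; 90; 119; 7; 17; 55; 7; 0; -15; 10; -4; -31]);
    (120, [:: 469; 29; 0; 0; -88; -19; -48; 32; 4; 0; -4; 40; -15; 0]);
    (106, [:: -247; 87; 101; -335; -34; -24; 30; 78; -101; 32; 12; -1; 6; 4]);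
    (122, [:: -21; 517; 0; 0; -85; -154; 192; -19; 24; 0; -14; 5; -32; 0]);
    (108, [:: -247; 87; 240; 255; -34; 38; 6; 49; 119; 32; 12; -5; -4; 4]);
    (124, [:: -21; 517; 0; 0; -85; 243; 37; -12; -28; 0; -14; 25; 20; 0]);
    (110, [:: 223; 361; 0; 0; 123; 0; 0; 0; 0; 15; 30; 0; 0; -20]);
    (126, [:: 512; -37; 0; 0; -63; 0; 0; 0; 0; 0; 4; 0; 0; 0])]);
  (49332, [::
    (64, [:: 776; 0; 432; -365; -422; -66; 0; -25; -24; 0; -35; 8; -35; 0]);
    (80, [:: -328; 0; 353; 168; 266; -291; 0; -23; -24; 0; -4; -11; 40; 0]);
    (66, [:: -181; 0; 977; -98; -30; 105; 0; -3; -6; 0; -28; 7; 39; 0]);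
    (82, [:: -1099; 0; -646; -684; -581; 347; 0; -11; -29; 0; 92; -6; 6; 0]);
    (68, [:: 411; -1369; 1032; -170; 296; -66; -51; 0; 1; -24; 13; 7; -12; 2]);
    (84, [:: -128; -332; -73; 373; -224; -210; -49; -10; 3; -21; 52; -9; 1; -24]);
    (70, [:: 283; 68; 166; 140; -514; -64; -30; 5; 2; -62; -3; 11; 29; -13]);
    (86, [:: -291; -426; 487; -113; 306; 245; -80; 1; 7; 49; 78; -11; 50; -25]);
    (72, [:: 411; 1369; 1032; -170; 296; -66; 51; 0; 1; 24; 13; 7; -12; -2]);
    (88, [:: -128; 332; -73; 373; -224; -210; 49; -10; 3; 21; 52; -9; 1; 24]);
    (74, [:: 283; -68; 166; 140; -514; -64; 30; 5; 2; 62; -3; 11; 29; 13]);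
    (90, [:: -291; 426; 487; -113; 306; 245; 80; 1; 7; -49; 78; -11; 50; 25]);
    (76, [:: 588; 0; -42; -505; 104; -189; 0; 20; -85; 0; 15; -5; -2; 0]);
    (92, [:: -134; 0; -261; 686; -317; -93; 0; 11; 25; 0; 90; -4; -34; 0]);
    (78, [:: 795; 0; 846; -758; -488; -8; 0; 15; 12; 0; -25; -23; -2; 0]);
    (94, [:: 168; 0; 340; 1503; 60; 322; 0; 20; -36; 0; 35; 8; -40; 0]);
    (96, [:: 470; 0; -350; -382; 499; -49; 0; -19; -3; 0; 91; 45; -9; 0]);
    (112, [:: -485; 0; 90; -244; 26; 79; 0; -37; 44; 0; -27; -4; -49; 0]);
    (98, [:: -1278; 0; 106; 302; -141; 182; 0; 7; 0; 0; -91; 11; -7; 0]);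
    (114, [:: -378; 0; -791; 256; 252; -82; 0; -15; -11; 0; -37; 10; 75; 0]);
    (100, [:: -967; 712; 345; -57; 664; -177; -55; 19; 9; -51; -26; 2; -2; 8]);
    (116, [:: -307; -673; -385; -248; 568; 83; -88; -6; -19; 26; 2; -14; -35; 23]);
    (102, [:: -102; -227; -354; -456; -42; 261; -80; 13; 0; -12; -40; 8; -13; 13]);
    (118, [:: 668; 1800; -668; 302; 111; 85; -87; -8; -8; 20; -67; -8; 24; -1]);
    (104, [:: -967; -712; 345; -57; 664; -177; 55; 19; 9; 51; -26; 2; -2; -8]);
    (120, [:: -307; 673; -385; -248; 568; 83; 88; -6; -19; -26; 2; -14; -35; -23]);
    (106, [:: -102; 227; -354; -456; -42; 261; 80; 13; 0; 12; -40; 8; -13; -13]);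
    (122, [:: 668; -1800; -668; 302; 111; 85; 87; -8; -8; -20; -67; -8; 24; 1]);
    (108, [:: -469; 0; -1057; -301; -221; -443; 0; 25; 15; 0; 15; -1; -4; 0]);
    (124, [:: 1319; 0; -534; 71; 600; -8; 0; -3; 11; 0; 23; -9; -22; 0]);
    (110, [:: 707; 0; -492; -589; 135; 93; 0; 26; 30; 0; 35; 10; 27; 0]);
    (126, [:: 1270; 0; -250; 289; 309; 185; 0; 4; 30; 0; -11; -8; 23; 0])]);
  (41396, [::
    (64, [:: 28; 0; -301; -524; -43; 119; 0; -63; -43; 4; 0; 35]);
    (72, [:: -605; 0; -28; -310; 334; 247; 0; 14; -13; 12; 0; -10]);
    (66, [:: 927; 821; -387; -92; 421; -25; -51; -6; -17; 11; 23; -8]);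
    (74, [:: -924; 566; 96; 42; 219; 56; -28; -3; -14; 20; 60; -2]);
    (68, [:: 927; -821; -387; -92; 421; -25; 51; -6; -17; 11; -23; -8]);
    (76, [:: -924; -566; 96; 42; 219; 56; 28; -3; -14; 20; -60; -2]);
    (70, [:: 317; 0; 767; -27; 326; -209; 0; -25; -27; 24; 0; 23]);
    (78, [:: 252; 0; -1559; 863; -405; -8; 0; 44; -36; 21; 0; -59]);
    (80, [:: 1216; 0; -545; -178; -721; 440; 0; -16; -14; -9; 0; 22]);
    (88, [:: -316; 0; 8; -60; -131; 270; 0; -22; 32; 2; 0; -21]);
    (82, [:: 597; 1797; 38; -227; 169; 25; -62; -51; 50; 0; -28; 9]);
    (90, [:: -27; -393; -16; 313; -316; 154; -62; -6; 16; 12; 56; -31]);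
    (84, [:: 597; -1797; 38; -227; 169; 25; 62; -51; 50; 0; 28; 9]);
    (92, [:: -27; 393; -16; 313; -316; 154; 62; -6; 16; 12; -56; -31]);
    (86, [:: 150; 0; 592; 853; 41; 274; 0; -59; 36; 17; 0; 77]);
    (94, [:: 72; 0; -338; 226; -186; -504; 0; -45; 38; 18; 0; -21]);
    (96, [:: -889; 0; -512; -1139; 49; -79; 0; -87; -41; -1; 0; -32]);
    (104, [:: -166; 0; 617; 207; 586; 273; 0; 61; -94; -32; 0; -38]);
    (98, [:: 42; 771; -1120; 181; 355; -145; -53; 15; 25; -19; 23; 30]);
    (106, [:: -1282; -1501; -103; 161; -121; -9; -149; 45; -8; -8; -6; 47]);
    (100, [:: 42; -771; -1120; 181; 355; -145; 53; 15; 25; -19; -23; 30]);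
    (108, [:: -1282; 1501; -103; 161; -121; -9; 149; 45; -8; -8; 6; 47]);
    (102, [:: 497; 0; 101; 53; 133; -245; 0; 73; -12; -3; 0; 34]);
    (110, [:: -492; 0; -688; -909; -621; -53; 0; 102; 10; 14; 0; 30]);
    (112, [:: 852; 0; -462; 113; 245; -11; 0; -29; 34; -37; 0; -25]);
    (120, [:: -1675; 0; -348; 266; -201; 28; 0; -68; 43; -24; 0; -11]);
    (114, [:: 517; 210; 340; -86; -567; -79; -99; -17; -13; -19; -10; 8]);
    (122, [:: -971; 134; 685; 113; -130; -127; -119; -9; 28; -9; -32; -28]);
    (116, [:: 517; -210; 340; -86; -567; -79; 99; -17; -13; -19; 10; 8]);
    (124, [:: -971; -134; 685; 113; -130; -127; 119; -9; 28; -9; 32; -28]);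
    (118, [:: 942; 0; 1362; 11; -451; -244; 0; 29; -33; -4; 0; -11]);
    (126, [:: 391; 0; 480; -517; 234; 181; 0; 104; 142; 4; 0; -30])]);
  (35764, [::
    (64, [:: 0; 0; -94; 465; -370; 0; 0; -55; 0; 0; -3]);
    (66, [:: 0; 0; 1; -14; -20; 0; 0; 21; 0; 0; 18]);
    (68, [:: -81; -31; -279; -192; 391; -247; -235; -13; 5; 7; 3]);
    (70, [:: -413; -159; -287; 326; 198; 9; 9; 42; -26; -33; -1]);
    (72, [:: 13; 85; -279; -192; 391; -80; 332; -13; 3; -8; 3]);
    (74, [:: 69; 437; -287; 326; 198; 3; -12; 42; -16; 39; -1]);
    (76, [:: 337; -272; -470; 161; 130; -25; 7; -13; -37; 5; -21]);
    (78, [:: -385; 311; 58; 236; -287; -254; 75; 18; 3; 0; -13]);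
    (80, [:: 67; -54; -279; -192; 391; 328; -96; -13; -9; 1; 3]);
    (82, [:: 344; -278; -287; 326; 198; -12; 4; 42; 42; -6; -1]);
    (84, [:: 67; 428; -470; 161; 130; 6; -26; -13; 14; -35; -21]);
    (86, [:: -77; -489; 58; 236; -287; 62; -257; 18; -1; 3; -13]);
    (88, [:: -404; -155; -470; 161; 130; 19; 18; -13; 23; 30; -21]);
    (90, [:: 462; 178; 58; 236; -287; 192; 183; 18; -2; -2; -13]);
    (92, [:: 0; 0; -609; -256; -193; 0; 0; 6; 0; 0; -41]);
    (94, [:: 0; 0; 285; -44; 302; 0; 0; -39; 0; 0; -11]);
    (96, [:: 0; 0; -187; 355; -39; 0; 0; -24; 0; 0; 21]);
    (98, [:: 0; 0; -219; -42; 9; 0; 0; 37; 0; 0; 35]);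
    (100, [:: -409; -157; -287; -334; -173; 69; 65; -31; -33; -42; 11]);
    (102, [:: 1223; 471; -256; 49; -239; -67; -64; 12; -18; -23; 15]);
    (104, [:: 68; 433; -287; -334; -173; 22; -92; -31; -20; 49; 11]);
    (106, [:: -204; -1294; -256; 49; -239; -22; 91; 12; -11; 27; 15]);
    (108, [:: -373; 302; 460; -86; 24; -83; 25; -22; -33; 5; -6]);
    (110, [:: 81; -66; 399; 265; 172; -196; 58; 5; -13; 2; 5]);
    (112, [:: 341; -275; -287; -334; -173; -91; 27; -31; 53; -8; 11]);
    (114, [:: -1019; 824; -256; 49; -239; 89; -26; 12; 29; -4; 15]);
    (116, [:: -75; -474; 460; -86; 24; 20; -84; -22; 12; -31; -6]);
    (118, [:: 16; 103; 399; 265; 172; 48; -199; 5; 5; -12; 5]);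
    (120, [:: 448; 172; 460; -86; 24; 63; 60; -22; 21; 26; -6]);
    (122, [:: -98; -38; 399; 265; 172; 148; 141; 5; 8; 10; 5]);
    (124, [:: 0; 0; 397; 9; -154; 0; 0; -14; 0; 0; -21]);
    (126, [:: 0; 0; 295; -636; -84; 0; 0; 97; 0; 0; -16])]);
  (51380, [::
    (64, [:: 0; 0; 109; 0; 54; 0; 0; -19; 0; 0; 0]);
    (66, [:: 0; 0; -67; 0; 0; 0; 0; -26; 0; 0; 0]);
    (68, [:: 204; 772; 92; -48; 36; -45; -6; -7; 4; -18; 4]);
    (70, [:: -99; -374; -50; -42; -19; -23; -3; -16; 6; 39; -8]);
    (80, [:: 772; -204; 92; 48; 36; 6; -45; -7; -4; -4; -18]);
    (82, [:: -374; 99; -50; 42; -19; 3; -23; -16; -6; 8; 39]);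
    (84, [:: -158; -92; 83; 0; 23; -29; -38; 5; 0; 18; 12]);
    (86, [:: -196; -114; -72; 0; -34; -25; -33; -3; 0; -4; -2]);
    (96, [:: -772; 204; 92; 48; 36; -6; 45; -7; -4; 4; 18]);
    (98, [:: 374; -99; -50; 42; -19; -3; 23; -16; -6; -8; -39]);
    (100, [:: 92; -158; 83; 0; 23; -38; 29; 5; 0; 12; -18]);
    (102, [:: 114; -196; -72; 0; -34; -33; 25; -3; 0; -2; 4]);
    (112, [:: 0; 0; -239; 47; 52; 0; 0; 13; -12; 0; 0]);
    (114, [:: 0; 0; 65; 4; -19; 0; 0; -8; -89; 0; 0]);
    (116, [:: 28; 108; 59; 50; 5; -44; -6; 18; 2; 11; -2]);
    (118, [:: -139; -526; -94; 77; -20; -25; -3; 6; 10; -58; 12]);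
    (72, [:: -204; -772; 92; -48; 36; 45; 6; -7; 4; 18; -4]);
    (74, [:: 99; 374; -50; -42; -19; 23; 3; -16; 6; -39; 8]);
    (76, [:: 0; 0; -239; -47; 52; 0; 0; 13; 12; 0; 0]);
    (78, [:: 0; 0; 65; -4; -19; 0; 0; -8; 89; 0; 0]);
    (88, [:: -92; 158; 83; 0; 23; 38; -29; 5; 0; -12; 18]);
    (90, [:: -114; 196; -72; 0; -34; 33; -25; -3; 0; 2; -4]);
    (92, [:: 108; -28; 59; -50; 5; 6; -44; 18; -2; 2; 11]);
    (94, [:: -526; 139; -94; -77; -20; 3; -25; 6; -10; -12; -58]);
    (104, [:: 158; 92; 83; 0; 23; 29; 38; 5; 0; -18; -12]);
    (106, [:: 196; 114; -72; 0; -34; 25; 33; -3; 0; 4; 2]);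
    (108, [:: -108; 28; 59; -50; 5; -6; 44; 18; -2; -2; -11]);
    (110, [:: 526; -139; -94; -77; -20; -3; 25; 6; -10; 12; 58]);
    (120, [:: -28; -108; 59; 50; 5; 44; 6; 18; 2; -11; 2]);
    (122, [:: 139; 526; -94; 77; -20; 25; 3; 6; 10; 58; -12]);
    (124, [:: 0; 0; -54; 0; -4; 0; 0; 33; 0; 0; 0]);
    (126, [:: 0; 0; 256; 0; -84; 0; 0; 17; 0; 0; 0])]);
  (57620, [::
    (66, [:: -13; -26; -37; -6; 20; -10]); (96, [:: 26; 13; -17; 33; -21; -4]);
    (98, [:: 88; -90; -46; 24; 2; 14]); (80, [:: -4; 29; -6; -37; -10; 19]);
    (82, [:: -124; 21; -37; -36; -9; -10]); (112, [:: 30; 59; -27; -4; -29; 14]);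
    (114, [:: -18; -34; -45; -7; -25; 12]); (68, [:: -28; 5; 27; 26; 15; 16]);
    (70, [:: -59; -29; -12; 24; 31; 6]); (100, [:: -19; 124; 8; 51; 6; -12]);
    (102, [:: 34; 17; -20; 40; 27; 5]); (84, [:: -46; 47; 24; -12; 4; 31]);
    (86, [:: -183; 31; 3; 3; -1; -1]); (116, [:: -28; 184; -1; -4; 0; -1]);
    (118, [:: -74; 75; -28; 14; 0; 2]); (72, [:: 20; -21; 33; -17; -3; -22]);
    (74, [:: 10; -65; -4; -27; 15; -28]); (104, [:: 65; -11; 19; 19; -22; -23]);
    (106, [:: 130; -133; 4; -2; 0; 1]); (88, [:: 113; 56; 23; -46; 13; 2]);
    (90, [:: -6; 38; -7; -44; 13; -24]); (120, [:: 166; 83; -2; 4; 1; 0]);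
    (122, [:: 104; -17; -22; -22; -1; -1]); (76, [:: -58; -112; 51; 8; -12; 6]);
    (78, [:: -86; -165; -4; -1; -1; 0]); (108, [:: -37; 6; 32; 32; -19; -20]);
    (110, [:: 16; -105; 5; 31; 1; -2]); (92, [:: 27; -27; 40; -21; 4; 27]);
    (94, [:: -95; -47; 14; -28; 2; 0]); (124, [:: 49; 94; 31; 5; -2; 1])]);
  (53428, [::
    (64, [:: 0; 4; 0; 0; -20]); (66, [:: 113; -20; -50; -5; -10]);
    (68, [:: 113; -20; 50; 5; -10]); (70, [:: 220; -45; 0; 0; -2]);
    (96, [:: -45; 61; 14; -19; -12]); (98, [:: 65; 37; -37; -23; -3]);
    (100, [:: 66; 36; 65; -13; -3]); (102, [:: 176; 15; 13; -18; 7]);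
    (80, [:: -45; 61; -14; 19; -12]); (82, [:: 66; 36; -65; 13; -3]);
    (84, [:: 65; 37; 37; 23; -3]); (86, [:: 176; 15; -13; 18; 7]);
    (112, [:: -76; 124; 0; 0; -2]); (114, [:: 23; 93; -52; -6; 5]);
    (116, [:: 23; 93; 52; 6; 5]); (118, [:: 121; 64; 0; 0; 13]);
    (72, [:: -137; -70; 0; 0; -11]); (74, [:: -25; -92; -50; -6; -2]);
    (76, [:: -25; -92; 50; 6; -2]); (78, [:: 51; -132; 0; 0; 0]);
    (104, [:: -175; -13; 16; -19; -3]); (106, [:: -67; -38; -36; -25; 6]);
    (108, [:: -69; -38; 66; -14; 6]); (110, [:: 55; -61; 18; -20; 14]);
    (88, [:: -175; -13; -16; 19; -3]); (90, [:: -69; -38; -66; 14; 6]);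
    (92, [:: -67; -38; 36; 25; 6]); (94, [:: 55; -61; -18; 20; 14]);
    (120, [:: -218; 42; 0; 0; 5]); (122, [:: -107; 18; -51; -5; 14]);
    (124, [:: -107; 18; 51; 5; 14]); (126, [:: -21; 20; 0; 0; 22])]);
  (43444, [::
    (64, [:: 0; 1144; 591; 0; 4; -34; 0; 5; 4]); (66, [:: 0; -196; 5; 0; 93; -65; 0; -9; 3]);
    (68, [:: -132; -258; 113; -190; 83; 53; -33; -1; 8]);
    (70, [:: -345; -206; 621; -47; 43; -23; -28; -11; -3]);
    (72, [:: 132; -258; 113; 190; 83; 53; 33; -1; 8]);
    (74, [:: 345; -206; 621; 47; 43; -23; 28; -11; -3]);
    (76, [:: 0; -279; 342; 0; 57; 101; 0; -5; 4]);
    (78, [:: 0; 408; -257; 0; 92; 28; 0; -21; -10]);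
    (96, [:: 519; 516; 15; 316; 42; -35; -17; 19; 5]);
    (98, [:: 334; -38; -767; 422; 55; -72; -8; -4; 3]);
    (100, [:: -381; -18; -90; 634; -3; 35; -26; 5; 4]);
    (102, [:: 514; 61; 234; 58; -16; -37; -47; -3; -6]);
    (104, [:: 815; -132; 198; 290; -61; 34; 14; 1; 6]);
    (106, [:: 796; -44; 210; 477; 52; -37; 21; 3; -3]);
    (108, [:: -486; 566; -766; 913; 53; 84; 11; 1; -1]);
    (110, [:: 991; 238; -499; 139; -44; 30; -26; -26; 1]);
    (80, [:: -519; 516; 15; -316; 42; -35; 17; 19; 5]);
    (82, [:: -334; -38; -767; -422; 55; -72; 8; -4; 3]);
    (84, [:: -815; -132; 198; -290; -61; 34; -14; 1; 6]);
    (86, [:: -796; -44; 210; -477; 52; -37; -21; 3; -3]);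
    (88, [:: 381; -18; -90; -634; -3; 35; 26; 5; 4]);
    (90, [:: -514; 61; 234; -58; -16; -37; 47; -3; -6]);
    (92, [:: 486; 566; -766; -913; 53; 84; -11; 1; -1]);
    (94, [:: -991; 238; -499; -139; -44; 30; 26; -26; 1]);
    (112, [:: 0; 49; -664; 0; -53; -24; 0; 13; 5]);
    (114, [:: 0; 174; -916; 0; -43; -88; 0; 0; -2]);
    (116, [:: -236; 295; -98; -111; -92; 13; -30; 12; -3]);
    (118, [:: -953; -1146; -265; 493; -80; -21; -8; -4; 3]);
    (120, [:: 236; 295; -98; 111; -92; 13; 30; 12; -3]);
    (122, [:: 953; -1146; -265; -493; -80; -21; 8; -4; 3]);
    (124, [:: 0; 202; 102; 0; -157; 61; 0; 4; -6]);
    (126, [:: 0; -1055; -504; 0; 117; 55; 0; 29; -13])]);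
  (57780, [::
    (64, [:: 0; 0; 0; 0; -6; 0]); (72, [:: 0; 70; -38; 0; -19; 16]);
    (80, [:: 0; -70; 38; 0; -19; 16]); (88, [:: 0; 0; 0; 0; -33; 31]);
    (66, [:: -132; 0; 0; 17; 33; -4]); (74, [:: 270; 57; -42; 19; 19; 11]);
    (82, [:: 270; -57; 42; 19; 19; 11]); (90, [:: -190; 0; 0; 16; 4; 26]);
    (68, [:: 132; 0; 0; -17; 33; -4]); (76, [:: -270; 57; -42; -19; 19; 11]);
    (84, [:: -270; -57; 42; -19; 19; 11]); (92, [:: 190; 0; 0; -16; 4; 26]);
    (70, [:: 0; 0; 0; 0; 69; -9]); (78, [:: 0; 53; -45; 0; 60; 7]);
    (86, [:: 0; -53; 45; 0; 60; 7]); (94, [:: 0; 0; 0; 0; 39; 18]);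
    (96, [:: 0; 0; 0; 0; -39; -20]); (104, [:: 0; 50; -45; 0; -56; -6]);
    (112, [:: 0; -50; 45; 0; -56; -6]); (120, [:: 0; 0; 0; 0; -70; 9]);
    (98, [:: 95; 0; 0; 18; -4; -27]); (106, [:: -208; 63; -40; 16; -18; -11]);
    (114, [:: -208; -63; 40; 16; -18; -11]); (122, [:: 11; 0; 0; 17; -32; 4]);
    (100, [:: -95; 0; 0; -18; -4; -27]); (108, [:: 208; 63; -40; -16; -18; -11]);
    (116, [:: 208; -63; 40; -16; -18; -11]); (124, [:: -11; 0; 0; -17; -32; 4]);
    (102, [:: 0; 0; 0; 0; 34; -31]); (110, [:: 0; 369; 46; 0; 19; -17]);
    (118, [:: 0; -369; -46; 0; 19; -17]); (126, [:: 0; 0; 0; 0; 15; -1])]);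
  (39860, [::
    (64, [:: 0; 0; 0; 0; 241; 466; -110; -628; 0; -165; 0; 0; -70; 0; -5]);
    (66, [:: -937; -202; 0; 0; 184; -296; -267; -41; 7; -17; 103; 0; 11; 0; 13]);
    (68, [:: 937; 202; 0; 0; 184; -296; -267; -41; -7; -17; -103; 0; 11; 0; 13]);
    (70, [:: 0; 0; 0; 0; -267; -267; 54; 86; 0; -174; 0; 0; -1; 0; 12]);
    (72, [:: 0; 0; 188; 0; -16; -388; 155; -76; 0; 52; 0; -24; -28; 8; -3]);
    (74, [:: -354; 908; 895; 494; 149; -181; -47; -13; 43; 42; 9; -13; -17; 0; 7]);
    (76, [:: 354; -908; 895; -494; 149; -181; -47; -13; -43; 42; -9; -13; -17; 0; 7]);
    (78, [:: 0; 0; 302; 0; -149; 242; -222; 109; 0; -79; 0; -15; -16; 13; 17]);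
    (80, [:: 0; 0; -188; 0; -16; -388; 155; -76; 0; 52; 0; 24; -28; -8; -3]);
    (82, [:: -354; 908; -895; -494; 149; -181; -47; -13; 43; 42; 9; 13; -17; 0; 7]);
    (84, [:: 354; -908; -895; 494; 149; -181; -47; -13; -43; 42; -9; 13; -17; 0; 7]);
    (86, [:: 0; 0; -302; 0; -149; 242; -222; 109; 0; -79; 0; 15; -16; -13; 17]);
    (88, [:: 0; 0; 0; 0; -374; -140; -135; -159; 0; 126; 0; 0; -18; 0; 6]);
    (90, [:: -206; 261; 0; 0; 515; -86; 20; 215; -314; 65; 54; 0; -61; 0; 1]);
    (92, [:: 206; -261; 0; 0; 515; -86; 20; 215; 314; 65; -54; 0; -61; 0; 1]);
    (94, [:: 0; 0; 0; 0; -225; 536; 365; 199; 0; 118; 0; 0; 2; 0; 29]);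
    (96, [:: 0; 0; 0; 0; 269; -222; -116; 351; 0; -99; 0; 0; -5; 0; -46]);
    (98, [:: 1096; 472; 0; 0; 69; 14; 257; 53; 87; -128; 16; 0; 35; 0; 2]);
    (100, [:: -1096; -472; 0; 0; 69; 14; 257; 53; -87; -128; -16; 0; 35; 0; 2]);
    (102, [:: 0; 0; 0; 0; 283; -155; -428; -249; 0; 142; 0; 0; 75; 0; 3]);
    (104, [:: 0; 0; 122; 0; -3; 212; 213; -71; 0; 51; 0; -24; 22; 15; -9]);
    (106, [:: 663; -40; -302; -769; 326; 272; -229; 52; -29; 7; 89; -31; 15; 22; -9]);
    (108, [:: -663; 40; -302; 769; 326; 272; -229; 52; 29; 7; -89; -31; 15; 22; -9]);
    (110, [:: 0; 0; -234; 0; 608; -172; 421; -178; 0; -5; 0; -70; 18; -29; -2]);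
    (112, [:: 0; 0; -122; 0; -3; 212; 213; -71; 0; 51; 0; 24; 22; -15; -9]);
    (114, [:: 663; -40; 302; 769; 326; 272; -229; 52; -29; 7; 89; 31; 15; -22; -9]);
    (116, [:: -663; 40; 302; -769; 326; 272; -229; 52; 29; 7; -89; 31; 15; -22; -9]);
    (118, [:: 0; 0; 234; 0; 608; -172; 421; -178; 0; -5; 0; 70; 18; 29; -2]);
    (120, [:: 0; 0; 0; 0; -18; 447; 131; 26; 0; 77; 0; 0; -12; 0; -16]);
    (122, [:: -308; -136; 0; 0; -597; -61; -6; -89; 277; 48; 70; 0; -9; 0; -28]);
    (124, [:: 308; 136; 0; 0; -597; -61; -6; -89; -277; 48; -70; 0; -9; 0; -28]);
    (126, [:: 0; 0; 0; 0; -264; -530; -66; -11; 0; -73; 0; 0; 12; 0; 2])]);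
  (59828, [::
    (64, [:: 0; 0; 0; -9; 0]); (66, [:: 0; 0; 0; -41; 0]); (68, [:: -9; 74; 0; 5; 18]);
    (70, [:: -9; 73; 0; -29; 18]); (96, [:: 9; -74; 0; 5; 18]); (98, [:: 9; -73; 0; -29; 18]);
    (100, [:: 0; 0; 0; 17; 35]); (102, [:: 0; 0; 0; -16; 35]); (72, [:: 74; 9; 0; 5; -18]);
    (74, [:: 73; 9; 0; -29; -18]); (76, [:: 64; 81; 2; 17; 0]); (78, [:: 60; 75; -94; -18; 0]);
    (104, [:: 81; -64; -2; 17; 0]); (106, [:: 75; -60; 94; -18; 0]);
    (108, [:: 71; 8; 0; 30; 18]); (110, [:: 84; 10; 0; -5; 18]); (80, [:: -74; -9; 0; 5; -18]);
    (82, [:: -73; -9; 0; -29; -18]); (84, [:: -81; 64; -2; 17; 0]);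
    (86, [:: -75; 60; 94; -18; 0]); (112, [:: -64; -81; 2; 17; 0]);
    (114, [:: -60; -75; -94; -18; 0]); (116, [:: -71; -8; 0; 30; 18]);
    (118, [:: -84; -10; 0; -5; 18]); (88, [:: 0; 0; 0; 17; -35]); (90, [:: 0; 0; 0; -16; -35]);
    (92, [:: -8; 71; 0; 30; -18]); (94, [:: -10; 84; 0; -5; -18]);
    (120, [:: 8; -71; 0; 30; -18]); (122, [:: 10; -84; 0; -5; -18]); (124, [:: 0; 0; 0; 42; 0]);
    (126, [:: 0; 0; 0; 32; 0])]);
  (48052, [::
    (64, [:: -308; 0; 0; 0; -44; 0; 0; 0; -27; 0; 0; 0]);
    (66, [:: 476; 0; 11; 168; -69; 0; 34; -38; -6; 0; 0; 0]);
    (68, [:: 476; 0; 140; -93; -69; 0; 16; 49; -6; 0; 0; 0]);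
    (70, [:: -175; 0; 185; 92; 33; 0; 47; 10; -37; 0; 0; 0]);
    (72, [:: 476; 0; -151; -75; -69; 0; -50; -10; -6; 0; 0; 0]);
    (74, [:: -175; 0; -172; 115; 33; 0; -15; -46; -37; 0; 0; 0]);
    (76, [:: -175; 0; -13; -207; 33; 0; -32; 36; -37; 0; 0; 0]);
    (78, [:: 123; 0; 0; 0; -143; 0; 0; 0; -13; 0; 0; 0]);
    (80, [:: -130; -199; 0; 0; 75; -48; 0; 0; -3; 0; 0; -20]);
    (82, [:: -133; 465; -35; -558; -106; 20; 11; -13; 3; 16; -7; -9]);
    (84, [:: -133; 465; -466; 309; -106; 20; 5; 16; 3; -14; -10; -9]);
    (86, [:: -12; 135; -71; -35; 75; -87; 34; 7; -23; -3; 39; 0]);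
    (88, [:: -133; 465; 501; 249; -106; 20; -17; -4; 3; -1; 17; -9]);
    (90, [:: -12; 135; 66; -44; 75; -87; -11; -33; -23; -32; -22; 0]);
    (92, [:: -12; 135; 5; 79; 75; -87; -23; 26; -23; 35; -17; 0]);
    (94, [:: 238; -211; 0; 0; -35; 11; 0; 0; 24; 0; 0; -38]);
    (96, [:: -130; 199; 0; 0; 75; 48; 0; 0; -3; 0; 0; 20]);
    (98, [:: -133; -465; -35; -558; -106; -20; 11; -13; 3; -16; 7; 9]);
    (100, [:: -133; -465; -466; 309; -106; -20; 5; 16; 3; 14; 10; 9]);
    (102, [:: -12; -135; -71; -35; 75; 87; 34; 7; -23; 3; -39; 0]);
    (104, [:: -133; -465; 501; 249; -106; -20; -17; -4; 3; 1; -17; 9]);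
    (106, [:: -12; -135; 66; -44; 75; 87; -11; -33; -23; 32; 22; 0]);
    (108, [:: -12; -135; 5; 79; 75; 87; -23; 26; -23; -35; 17; 0]);
    (110, [:: 238; 211; 0; 0; -35; -11; 0; 0; 24; 0; 0; 38]);
    (112, [:: 44; 0; 0; 0; 165; 0; 0; 0; 31; 0; 0; 0]);
    (114, [:: -385; 0; 4; 59; -125; 0; 36; -41; 18; 0; 0; 0]);
    (116, [:: -385; 0; 49; -32; -125; 0; 17; 52; 18; 0; 0; 0]);
    (118, [:: -120; 0; 159; 79; 198; 0; 17; 3; 25; 0; 0; 0]);
    (120, [:: -385; 0; -53; -26; -125; 0; -53; -11; 18; 0; 0; 0]);
    (122, [:: -120; 0; -148; 99; 198; 0; -5; -16; 25; 0; 0; 0]);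
    (124, [:: -120; 0; -11; -178; 198; 0; -11; 13; 25; 0; 0; 0]);
    (126, [:: 87; 0; 0; 0; -49; 0; 0; 0; -8; 0; 0; 0])]);
  (64436, [::
    (64, [:: 13; 0; 0; 0; 0; -7]); (66, [:: -33; -60; 11; 48; -37; 1]);
    (68, [:: -33; -27; -5; -9; 81; 1]); (70, [:: 10; 19; -1; -9; -10; -20]);
    (72, [:: -33; 9; 60; -57; -22; 1]); (74, [:: 10; 11; -16; 2; 13; -20]);
    (76, [:: 10; 4; -12; 15; -13; -20]); (78, [:: -35; -14; 11; -3; 4; 25]);
    (80, [:: -33; 69; 9; 50; 7; 1]); (82, [:: 10; -2; -4; -22; 7; -20]);
    (84, [:: 10; -9; -1; -9; -19; -20]); (86, [:: -35; -3; 2; 16; 9; 25]);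
    (88, [:: 10; -17; -15; 2; 3; -20]); (90, [:: -35; 3; 14; 7; -9; 25]);
    (92, [:: -35; 9; 11; -3; 11; 25]); (94, [:: 79; -13; 106; 47; 41; 26]);
    (96, [:: -33; 9; -74; -32; -28; 1]); (98, [:: 10; 11; 14; -4; 14; -20]);
    (100, [:: 10; 4; 18; 9; -12; -20]); (102, [:: -35; -14; -12; 1; 3; 25]);
    (104, [:: 10; -4; 3; 20; 11; -20]); (106, [:: -35; -7; -1; -7; -15; 25]);
    (108, [:: -35; -2; -3; -17; 5; 25]); (110, [:: 79; -99; -13; -72; -10; 26]);
    (112, [:: 10; -17; 14; -4; 5; -20]); (114, [:: -35; 3; -9; 12; -10; 25]);
    (116, [:: -35; 9; -12; 1; 10; 25]); (118, [:: 79; -13; -86; 82; 32; 26]);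
    (120, [:: -35; 15; -1; -7; -8; 25]); (122, [:: 79; 39; 7; 13; -116; 26]);
    (124, [:: 79; 86; -15; -70; 53; 26]); (126, [:: -26; 0; 0; 0; 0; -16])])].

(** Three roots and two further vertices. The type with key 68 has a single edge, that with key 84
    is a path with two edges. *)
Definition cert7_sq3 : seq (Z * seq (Z * seq Z)) := [::
  (68, [::
    (512, [:: 0; -7; -36; 0; 10; 7; 0; -8; 0; -1; 0; -14; 2; 0; 0; 4; 4]);
    (514, [:: 46; 5; 137; 21; -68; -47; -25; 12; -57; 60; -76; 7; -16; -1; -6; -27; -10]);
    (546, [:: -43; -9; -22; -94; -20; 17; 122; 40; 93; -65; 10; 4; 31; 84; 24; -1; 5]);
    (516, [:: -46; 5; 137; -21; -68; -47; 25; 12; 57; 60; 76; 7; -16; 1; 6; -27; -10]);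
    (518, [:: 0; -12; -212; 0; 238; -81; 0; -226; 0; 28; 0; -10; 36; 0; 0; 14; -1]);
    (578, [:: 0; 72; 2; 0; -261; -564; 0; 77; 0; 266; 0; 160; 105; 0; 0; 51; 6]);
    (550, [:: 90; -349; 335; 110; -1; 193; -43; -318; 96; 58; 166; -14; -13; -41; 94; 9; 15]);
    (580, [:: 43; -9; -22; 94; -20; 17; -122; 40; -93; -65; -10; 4; 31; -84; -24; -1; 5]);
    (582, [:: -90; -349; 335; -110; -1; 193; 43; -318; -96; 58; -166; -14; -13; 41; -94; 9; 15]);
    (614, [:: 0; -6; 2; 0; 146; -270; 0; -246; 0; 74; 0; -10; -172; 0; 0; -49; -10]);
    (520, [:: 0; 408; -72; 0; 23; 92; 0; 137; 0; -99; 0; -46; 1; 0; 0; -22; -5]);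
    (522, [:: 41; -33; 10; -186; 113; 28; 5; -7; 99; -244; 97; 58; 61; -247; 1; 52; 26]);
    (642, [:: -62; 205; 148; 38; 365; 75; 91; 280; 14; -23; 121; 15; -117; 163; -138; 52; -23]);
    (554, [:: -34; 32; -110; 22; 22; 128; -411; -170; 95; -5; -104; -113; -81; -116; -150; 98; -15]);
    (524, [:: -41; -33; 10; 186; 113; 28; -5; -7; -99; -244; -97; 58; 61; 247; -1; 52; 26]);
    (526, [:: 0; -45; 277; 0; 313; 122; 0; 734; 0; 92; 0; 190; 16; 0; 0; 41; 49]);
    (706, [:: -1158; 429; 332; 125; 38; -141; -583; -217; 98; -75; -71; 168; -36; 27; 204; 24; -31]);
    (558, [:: 122; 669; -644; -597; -22; 243; -166; -289; -213; -73; -99; -41; 21; -197; 13; -44; 10]);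
    (644, [:: 62; 205; 148; -38; 365; 75; -91; 280; -14; -23; -121; 15; -117; -163; 138; 52; -23]);
    (586, [:: 1158; 429; 332; -125; 38; -141; 583; -217; -98; -75; 71; 168; -36; -27; -204; 24; -31]);
    (646, [:: 0; -60; 42; 0; 233; -106; 0; -58; 0; -178; 0; -127; 75; 0; 0; 44; 31]);
    (678, [:: -794; -128; -521; -111; -114; 84; -66; -158; 509; -30; 89; 24; -132; -20; -15; 99; -20]);
    (588, [:: 34; 32; -110; -22; 22; 128; 411; -170; -95; -5; 104; -113; -81; 116; 150; 98; -15]);
    (590, [:: -122; 669; -644; 597; -22; 243; 166; -289; 213; -73; 99; -41; 21; 197; -13; -44; 10]);
    (710, [:: 794; -128; -521; 111; -114; 84; 66; -158; -509; -30; -89; 24; -132; 20; 15; 99; -20]);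
    (622, [:: 0; 340; 34; 0; 270; 492; 0; -104; 0; -633; 0; 160; 38; 0; 0; -55; -6]);
    (648, [:: 0; 106; -11; 0; -185; -158; 0; 339; 0; -38; 0; 90; -64; 0; 0; -30; -25]);
    (650, [:: -397; 35; 115; 190; -1; 59; 537; 93; 23; -30; -75; 65; -119; 25; -58; 5; 39]);
    (682, [:: 412; 152; 164; -57; -226; -5; 156; -103; 64; -10; -59; -81; 35; -48; 86; 24; 8]);
    (652, [:: 397; 35; 115; -190; -1; 59; -537; 93; -23; -30; 75; 65; -119; -25; 58; 5; 39]);
    (654, [:: 0; 359; 491; 0; 179; -22; 0; -248; 0; -144; 0; -452; -15; 0; 0; -101; 5]);
    (714, [:: 0; -534; -563; 0; 320; 230; 0; 172; 0; -37; 0; 118; -136; 0; 0; -8; 57]);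
    (686, [:: -599; 274; -132; -368; 128; -160; 361; 178; -126; -16; -403; -168; 183; -22; -15; -14; -34]);
    (716, [:: -412; 152; 164; 57; -226; -5; -156; -103; -64; -10; 59; -81; 35; 48; -86; 24; 8]);
    (718, [:: 599; 274; -132; 368; 128; -160; -361; 178; 126; -16; 403; -168; 183; 22; 15; -14; -34]);
    (750, [:: 0; -278; -237; 0; 266; 415; 0; -90; 0; 197; 0; 83; 100; 0; 0; 1; -17]);
    (768, [:: 0; -312; 221; 0; -205; 133; 0; -113; 0; -87; 0; 78; 2; 0; 0; -33; -19]);
    (770, [:: -363; -33; -337; 262; 22; 63; 174; -46; -150; 94; 250; -44; -111; -33; 47; -33; -23]);
    (802, [:: 107; 461; -181; 436; 118; 70; 195; 38; -33; -31; -67; 28; -29; -6; -24; 10; 1]);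
    (772, [:: 363; -33; -337; -262; 22; 63; -174; -46; 150; 94; -250; -44; -111; 33; -47; -33; -23]);
    (774, [:: 0; -144; 307; 0; 141; -31; 0; 164; 0; 61; 0; -1; 153; 0; 0; 54; -26]);
    (834, [:: 0; 19; 15; 0; 277; 121; 0; -56; 0; -36; 0; 6; -26; 0; 0; 30; 21]);
    (806, [:: 126; -12; -177; -265; -25; -182; 54; 197; -224; -84; 82; -37; 181; -20; 20; 4; 14]);
    (836, [:: -107; 461; -181; -436; 118; 70; -195; 38; 33; -31; 67; 28; -29; 6; 24; 10; 1]);
    (838, [:: -126; -12; -177; 265; -25; -182; -54; 197; 224; -84; -82; -37; 181; 20; -20; 4; 14]);
    (870, [:: 0; 91; -52; 0; -26; 14; 0; 132; 0; 54; 0; -57; -16; 0; 0; -18; -13]);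
    (776, [:: 0; -320; 382; 0; 510; 30; 0; -203; 0; -281; 0; 224; 68; 0; 0; 5; 3]);
    (778, [:: -311; 225; -75; -98; 147; -223; 127; 63; -145; 159; 203; 187; 22; -38; 50; 1; -6]);
    (898, [:: 739; -347; 361; -452; 37; 57; -451; 84; 283; 87; -299; -10; 97; 123; -99; 22; -14]);
    (810, [:: 365; -510; -183; 546; 29; 138; -343; 143; -255; -53; 165; -251; 30; -73; -120; -10; -7]);
    (780, [:: 311; 225; -75; 98; 147; -223; -127; 63; 145; 159; -203; 187; 22; 38; -50; 1; -6]);
    (782, [:: 0; -73; 56; 0; -140; -284; 0; 46; 0; -59; 0; -189; -188; 0; 0; 36; 27]);
    (962, [:: -273; -197; 132; -113; -38; -51; 526; 108; -25; -24; -266; 108; 26; -76; 12; -64; -19]);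
    (814, [:: 89; -203; 385; -188; -604; 81; -109; -161; -4; -70; 13; 97; -85; -248; 98; 7; 29]);
    (900, [:: -739; -347; 361; 452; 37; 57; 451; 84; -283; 87; 299; -10; 97; -123; 99; 22; -14]);
    (842, [:: 273; -197; 132; 113; -38; -51; -526; 108; 25; -24; 266; 108; 26; 76; -12; -64; -19]);
    (902, [:: 0; 700; -29; 0; -847; 362; 0; -337; 0; 433; 0; 154; 171; 0; 0; 20; -6]);
    (934, [:: -332; -313; -162; 195; -297; 244; -260; 264; -136; 14; -154; -234; -22; 62; -113; -56; -3]);
    (844, [:: -365; -510; -183; -546; 29; 138; 343; 143; 255; -53; -165; -251; 30; 73; 120; -10; -7]);
    (846, [:: -89; -203; 385; 188; -604; 81; 109; -161; 4; -70; -13; 97; -85; 248; -98; 7; 29]);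
    (966, [:: 332; -313; -162; -195; -297; 244; 260; 264; 136; 14; 154; -234; -22; -62; 113; -56; -3]);
    (878, [:: 0; 213; 299; 0; -983; 255; 0; 440; 0; -64; 0; 127; -111; 0; 0; -6; -6]);
    (904, [:: 0; -269; -91; 0; 76; 187; 0; -128; 0; 139; 0; 61; -44; 0; 0; -13; -5]);
    (906, [:: -19; 11; -406; -995; 91; -454; 66; -173; -353; 23; 221; 133; 108; 196; 6; -106; 35]);
    (938, [:: 251; 255; 485; 203; 206; 83; -99; -32; -47; 161; -71; -40; 7; 90; 149; -5; 7]);
    (908, [:: 19; 11; -406; 995; 91; -454; -66; -173; 353; 23; -221; 133; 108; -196; -6; -106; 35]);
    (910, [:: 0; -404; -364; 0; -92; -842; 0; -128; 0; 363; 0; -63; 13; 0; 0; 62; 13]);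
    (970, [:: 0; 23; 305; 0; 106; 192; 0; 98; 0; 190; 0; 57; -41; 0; 0; -163; 22]);
    (942, [:: -404; -167; 393; 157; 510; -247; -303; -3; -490; -92; -247; -4; -58; -6; 12; 17; -20]);
    (972, [:: -251; 255; 485; -203; 206; 83; 99; -32; 47; 161; 71; -40; 7; -90; -149; -5; 7]);
    (974, [:: 404; -167; 393; -157; 510; -247; 303; -3; 490; -92; 247; -4; -58; 6; -12; 17; -20]);
    (1006, [:: 0; -166; 84; 0; -122; -196; 0; -204; 0; -244; 0; 49; 68; 0; 0; -2; -19])]);
  (84, [::
    (512, [:: 25; 0; 90; 45; 0; 41; -62; -90; 0; -59; -39; 0; 0; -5]);
    (514, [:: -24; 0; -133; 145; 0; -77; 121; 155; 0; 171; 115; 0; 0; -9]);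
    (546, [:: -28; 0; 44; -54; 0; -53; -42; -10; 0; -28; -49; 0; 0; 3]);
    (516, [:: -53; 5; -50; -70; -77; -51; -18; 48; 150; -38; -195; -53; 8; 3]);
    (518, [:: -96; 300; -370; -464; 26; -40; -39; -72; 387; 141; 165; 43; 24; -26]);
    (578, [:: -167; -122; 155; 283; 61; 121; 9; 34; 103; -3; 151; -25; -61; -2]);
    (550, [:: 30; 181; 128; 58; -277; -124; -64; -135; 26; 11; -44; 28; -12; -42]);
    (580, [:: 55; -92; -208; 27; 37; -255; 0; 11; -85; -19; 0; 43; 14; 0]);
    (582, [:: 176; 161; -29; 86; 560; -48; 206; 128; -123; 22; -13; -16; -85; -6]);
    (614, [:: 46; -9; 101; -175; 60; 51; -61; -246; -75; -78; -26; 4; -22; -8]);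
    (520, [:: -53; -5; -50; -70; 77; -51; -18; 48; -150; -38; -195; 53; -8; 3]);
    (522, [:: -96; -300; -370; -464; -26; -40; -39; -72; -387; 141; 165; -43; -24; -26]);
    (642, [:: -167; 122; 155; 283; -61; 121; 9; 34; -103; -3; 151; 25; 61; -2]);
    (554, [:: 30; -181; 128; 58; 277; -124; -64; -135; -26; 11; -44; -28; 12; -42]);
    (524, [:: -19; 0; -139; -370; 0; 69; -137; 60; 0; -17; -28; 0; 0; 30]);
    (526, [:: 33; 0; -72; 22; 0; 172; -357; 158; 0; 20; -120; 0; 0; 27]);
    (706, [:: -3; 0; -44; -168; 0; 67; 332; 57; 0; 238; -81; 0; 0; -5]);
    (558, [:: -325; 0; 232; 69; 0; -77; -235; 20; 0; -143; -34; 0; 0; 4]);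
    (644, [:: -915; 0; 426; 80; 0; -129; -207; -604; 0; -19; 44; 0; 0; 18]);
    (586, [:: -281; 58; -467; 559; -102; 561; -30; -94; 68; 149; -42; 14; 140; -32]);
    (646, [:: -281; -58; -467; 559; 102; 561; -30; -94; -68; 149; -42; -14; -140; -32]);
    (678, [:: -6; 0; -214; 142; 0; -228; -195; 228; 0; -220; -37; 0; 0; -149]);
    (588, [:: -229; 245; -44; -435; -465; 250; 66; -96; -234; 116; -32; -71; 100; 6]);
    (590, [:: -740; 751; 265; 36; -48; -95; -90; 90; 125; -6; 39; -68; 47; -9]);
    (710, [:: -361; 46; -253; -280; -429; -23; 70; 248; -225; -80; -17; -17; -143; -2]);
    (622, [:: -142; 646; -115; 218; -229; 108; -271; 76; -36; 112; -30; -97; -102; 14]);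
    (648, [:: 55; 92; -208; 27; -37; -255; 0; 11; 85; -19; 0; -43; -14; 0]);
    (650, [:: 176; -161; -29; 86; -560; -48; 206; 128; 123; 22; -13; 16; 85; -6]);
    (682, [:: 46; 9; 101; -175; -60; 51; -61; -246; 75; -78; -26; -4; 22; -8]);
    (652, [:: -229; -245; -44; -435; 465; 250; 66; -96; 234; 116; -32; 71; -100; 6]);
    (654, [:: -740; -751; 265; 36; 48; -95; -90; 90; -125; -6; 39; 68; -47; -9]);
    (714, [:: -361; -46; -253; -280; 429; -23; 70; 248; 225; -80; -17; 17; 143; -2]);
    (686, [:: -142; -646; -115; 218; 229; 108; -271; 76; 36; 112; -30; 97; 102; 14]);
    (716, [:: -49; 0; 81; 46; 0; 42; 82; 97; 0; -159; 55; 0; 0; 11]);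
    (718, [:: 216; 0; -29; 19; 0; 93; 1; 28; 0; -121; -22; 0; 0; 23]);
    (750, [:: 217; 0; 113; -199; 0; -163; 34; -42; 0; 146; 92; 0; 0; -6]);
    (768, [:: -304; 0; -600; 129; 0; -217; 419; -135; 0; -106; -2; 0; 0; 21]);
    (770, [:: 416; 0; 98; -254; 0; 302; 238; -78; 0; -143; 153; 0; 0; -5]);
    (802, [:: -15; 0; -255; 78; 0; 90; -231; 41; 0; -145; 25; 0; 0; 42]);
    (772, [:: -628; 636; -76; -351; -131; -257; -58; 23; 37; -27; 33; 13; -19; 13]);
    (774, [:: 351; -1; 169; 557; 58; 266; 293; -181; 30; -50; 23; -66; 25; -9]);
    (834, [:: -61; 340; -102; -120; 159; 404; 35; 197; 132; -78; 64; 29; -48; -15]);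
    (806, [:: -114; -493; -127; -16; -106; 154; -26; -44; 82; -89; -88; -28; 91; 28]);
    (836, [:: 486; 379; -338; -152; -61; -27; -106; 11; -114; -52; -10; 139; -3; -3]);
    (838, [:: -91; 106; 529; -200; 870; -102; 225; 187; -46; -108; -34; -37; 48; -4]);
    (870, [:: 34; -389; 284; -42; 86; -34; 167; -56; -173; -9; -27; 15; 43; 42]);
    (776, [:: -628; -636; -76; -351; 131; -257; -58; 23; -37; -27; 33; -13; 19; 13]);
    (778, [:: 351; 1; 169; 557; -58; 266; 293; -181; -30; -50; 23; 66; -25; -9]);
    (898, [:: -61; -340; -102; -120; -159; 404; 35; 197; -132; -78; 64; -29; 48; -15]);
    (810, [:: -114; 493; -127; -16; 106; 154; -26; -44; -82; -89; -88; 28; -91; 28]);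
    (780, [:: -189; 0; -242; 204; 0; -186; -223; -119; 0; 191; 47; 0; 0; 16]);
    (782, [:: 90; 0; 372; 2; 0; 337; -57; 129; 0; -13; -65; 0; 0; -18]);
    (962, [:: 39; 0; -127; 57; 0; -38; -26; -131; 0; 164; -42; 0; 0; -21]);
    (814, [:: -53; 0; 132; -27; 0; -74; 51; 64; 0; -14; -45; 0; 0; 5]);
    (900, [:: 701; 0; -307; 156; 0; -114; -262; -606; 0; -40; 70; 0; 0; 80]);
    (842, [:: 379; -285; 321; 324; -9; -161; 95; 170; -135; -54; 88; -108; -127; 26]);
    (902, [:: 379; 285; 321; 324; 9; -161; 95; 170; 135; -54; 88; 108; 127; 26]);
    (934, [:: -284; 0; -335; 307; 0; -247; -224; 161; 0; -162; 142; 0; 0; 39]);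
    (844, [:: 456; -394; 228; 283; -608; -532; -84; -42; -125; 109; -52; 7; 26; -22]);
    (846, [:: 470; -981; 25; -210; -240; 22; 239; 23; 364; -57; -41; 100; -109; -45]);
    (966, [:: -17; 97; 155; -137; -177; -97; -171; 96; -188; 125; -9; -105; 29; 49]);
    (878, [:: 479; 178; 29; 91; -275; 113; 4; 211; 214; 115; 0; -31; 76; 66]);
    (904, [:: 486; -379; -338; -152; 61; -27; -106; 11; 114; -52; -10; -139; 3; -3]);
    (906, [:: -91; -106; 529; -200; -870; -102; 225; 187; 46; -108; -34; 37; -48; -4]);
    (938, [:: 34; 389; 284; -42; -86; -34; 167; -56; 173; -9; -27; -15; -43; 42]);
    (908, [:: 456; 394; 228; 283; 608; -532; -84; -42; 125; 109; -52; -7; -26; -22]);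
    (910, [:: 470; 981; 25; -210; 240; 22; 239; 23; -364; -57; -41; -100; 109; -45]);
    (970, [:: -17; -97; 155; -137; 177; -97; -171; 96; 188; 125; -9; 105; -29; 49]);
    (942, [:: 479; -178; 29; 91; 275; 113; 4; 211; -214; 115; 0; 31; -76; 66]);
    (972, [:: 61; 0; 351; 122; 0; -121; -183; -34; 0; -99; 49; 0; 0; -36]);
    (974, [:: -268; 0; -273; 343; 0; -375; 253; -87; 0; 99; -107; 0; 0; -50]);
    (1006, [:: 67; 0; -6; -138; 0; 192; 105; -140; 0; -27; 58; 0; 0; -30])])].

(** Each key is one labelling of a six-vertex graph, with the vertex whose degree is bounded in the
    first place; labellings that are not listed have multiplier zero. *)
Definition cert7_deg : seq (Z * Z) := [::
  (2492564, 118435); (3281716, 1839806); (3046324, 49472); (2630180, 59590); (2257684, 75630);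
  (2257844, 30402); (2102036, 73510); (2257696, 5556); (2503092, 14185); (3936692, 4179311);
  (2109588, 15694); (2630436, 17361); (3154212, 31); (2634516, 65950); (2508980, 7063);
  (2097588, 828639); (2496948, 18222); (3952820, 12002); (2234804, 1565028); (2114324, 11299);
  (3412116, 6059); (2908708, 28487); (2126260, 32110); (3480500, 60659); (2626324, 64859);
  (2241460, 92311); (3146676, 35584); (2106148, 1828); (2773268, 33092); (3033268, 48530);
  (3691316, 26673); (2101396, 14037); (2782004, 388316); (2634532, 74741); (2309044, 1281267);
  (4065428, 265262); (3694868, 26789); (3414964, 15313200); (3016884, 35577); (2912692, 16319);
  (3174580, 5472765); (2638644, 4233978); (2904340, 60911); (3158452, 3790628); (3814324, 3999);
  (2101684, 112065); (2122532, 18941); (2363540, 19477); (3281684, 4968624); (3953460, 45905);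
  (2493364, 38310); (3687220, 56665); (2232500, 27015); (4092852, 4476); (2104244, 476304);
  (2767796, 485651); (2169780, 2201466); (3303860, 1932141); (2164916, 398222);
  (3162932, 23336); (3674932, 16799735); (2233120, 3294); (2117908, 1914644); (3412404, 8037);
  (3682452, 17813243); (2097300, 1117); (2368292, 61725); (2625716, 72301); (2773300, 72014);
  (2097940, 1935); (2124212, 14450); (2105632, 1160); (2233140, 11391); (2365876, 232455);
  (3698868, 83008); (2230420, 40520); (2781972, 7684); (2629940, 23739); (2101524, 28182);
  (3686708, 1676109); (2702260, 39612); (2113568, 1179); (3150004, 2666545); (3674388, 6544261);
  (2255284, 42112); (3305652, 45445); (2232628, 28498); (4092084, 46600); (2646324, 327972);
  (3428532, 64390); (3694900, 88805); (2238900, 14452089); (2890676, 14138); (2114084, 28668);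
  (2833332, 32792); (2367924, 530931); (3416500, 226029); (2773172, 4501871); (2118452, 29084);
  (2113844, 5032510); (3541940, 8274114); (2097332, 1148228); (3934644, 18335);
  (2763188, 8582931); (3682484, 886777); (3686676, 49512); (3687188, 280507);
  (2259892, 4573182); (3281044, 170554); (3683124, 2139801); (3568052, 47965); (2097700, 4038);
  (3281700, 7093); (2364196, 38607); (2633876, 3648410); (2364340, 43839); (3298068, 202672);
  (2771124, 45608); (2097444, 5430); (2240692, 22553); (2122164, 65237); (2368004, 63522);
  (3546036, 3748557); (3686452, 8242); (2240948, 31645); (3939252, 2752778); (3289268, 13491);
  (2886068, 61440); (3145876, 9910); (3682740, 11317263); (2908452, 20504); (2097188, 881);
  (2105620, 8472); (2642740, 3053700); (3174836, 6589997); (2519476, 25326); (2634548, 3702);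
  (2112436, 852661); (2246836, 29320); (3944884, 16195); (3148212, 975135); (2230708, 9956);
  (3174548, 23326); (3044116, 2939); (3679012, 17978); (3436980, 8103579); (2231220, 90153);
  (3830548, 8941362); (3166388, 1212348); (2650292, 3054400); (2888484, 162328);
  (2249492, 7180); (3146516, 109116); (2300852, 71149); (2887956, 50002); (2097460, 3309788);
  (2955700, 1799931); (2634676, 5217); (2629920, 6119); (2128820, 266373); (2764980, 59653);
  (2904884, 2898); (3881908, 2600); (3953428, 19583); (2113588, 7293); (2101540, 6030);
  (3685300, 406598); (3672244, 3646847); (2361780, 4774156); (3811764, 26332);
  (2241332, 1594029); (3150260, 622564); (2642196, 45650); (2637860, 5184091); (2492852, 35701);
  (2233124, 16176); (3158196, 22912); (4066228, 3539463); (2629908, 49529); (2638100, 112517);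
  (2117940, 535); (2638372, 2290996); (2519844, 1629016); (2105860, 3501); (3146276, 11888);
  (2625812, 30348); (2629924, 42836); (3674420, 58488); (2623668, 16908); (2626356, 5561314);
  (2379956, 42883); (3938740, 1995187); (2164884, 67357); (3025332, 158450); (3146016, 5617);
  (2240660, 64323); (2300340, 69959); (3305908, 14664); (2646564, 52262); (2364192, 44173);
  (3412772, 55652); (3416356, 70062); (3936532, 14064953); (2519860, 574); (3683252, 7682550);
  (2773812, 22633); (2126004, 6870); (2117812, 26303); (2235316, 165846); (2249012, 6995);
  (2241300, 12719); (2380564, 96865); (2103732, 1370797); (3541428, 37320); (2165684, 600190);
  (2890164, 4786083); (3043764, 1268913); (2517428, 4487); (3162900, 11012112);
  (3750836, 11488); (2125972, 833); (2257332, 37077); (4004276, 526284); (3281076, 65448);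
  (2503476, 2337); (2637876, 1037); (3154724, 154527); (2887988, 13838); (3410356, 847856);
  (2587572, 2984042); (3148724, 20126); (2372388, 26401); (2913060, 6349); (3429140, 39768);
  (3822356, 131681); (4065716, 4026499); (3957172, 1316215); (2363680, 2328); (3111860, 392317);
  (3150644, 12133517); (3678644, 80336); (3041716, 75328); (2233108, 18154); (3281696, 4568);
  (4069812, 737225); (2122036, 53361); (2503460, 15913); (3952916, 31494); (2642228, 134598);
  (3146244, 1609); (3154356, 12492829); (2363668, 57311); (2097972, 18750); (2388404, 4051316);
  (3551412, 17037); (4092340, 3534); (3290036, 1043132); (2384308, 24106); (3567796, 6835935);
  (2169268, 1785130); (2097668, 4978); (3699476, 11855); (2113572, 5378); (3412768, 39778);
  (3175348, 21341); (3283892, 108594); (2177972, 15404); (2519188, 1105938); (3043476, 14608);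
  (3674900, 31567); (3167028, 396866); (2099380, 15455); (3432740, 176531); (3218356, 1990901);
  (3683108, 67488); (2232468, 25547); (3432884, 147951); (2098100, 575); (3814164, 3718);
  (2363700, 62873); (3678756, 1784855); (2492596, 31916); (2908676, 27187); (3678500, 17645);
  (2110244, 224006); (3297460, 110271); (2888116, 824486); (2887968, 20827); (2781364, 69893);
  (2325428, 2986304); (2102068, 90446); (2113812, 18023); (3016852, 214513); (2765588, 20791);
  (2522036, 85677); (4160436, 4664); (3017652, 59060); (3829940, 24530); (3171108, 81280);
  (2100148, 147444); (2634164, 5016767); (3152820, 1300489); (4070324, 2563145);
  (2773780, 1043165); (2233268, 12103); (3150772, 8645930); (3551380, 246796); (3145908, 65719);
  (3551668, 1824724); (2122020, 28019); (3170740, 52431); (2904372, 558724); (2384164, 14791);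
  (3803316, 2084817); (2097428, 12021); (2638132, 75413); (2105636, 27727); (2097204, 281);
  (2642100, 6651150); (3021236, 56339); (4078516, 22447); (2636724, 5259273); (3162420, 31836);
  (2113716, 126060); (2102196, 88412); (2642708, 30452); (2257044, 28992); (4065460, 2106200);
  (3289236, 5628401); (3146164, 85903); (2519988, 67045); (3287476, 13809); (3281332, 1052438);
  (3690772, 6104); (2105780, 2788903); (2380596, 92756); (2257076, 1676); (2887972, 15480);
  (4092052, 10651); (3281844, 1748581); (2363684, 23162); (3158164, 27552); (2503604, 28603);
  (2101556, 465993); (3305620, 347358); (3429172, 22973); (2366388, 194687); (2497460, 193510);
  (3813524, 4112); (2632116, 2135244); (3279796, 2377017); (2165172, 2388210); (2380084, 47312);
  (2122276, 3729689); (2101428, 51273); (2109876, 124875); (3936564, 185513); (2502804, 38084);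
  (4073908, 1878); (3678516, 32709); (3690676, 617155); (2908596, 51189); (2110228, 11876);
  (3017140, 94845); (3936548, 524260); (2697652, 43858); (3568564, 29428); (2638004, 65465);
  (2765620, 6371); (3814196, 121); (3678484, 54738); (2099636, 3909792); (2363828, 3169207);
  (3043508, 33783); (2650900, 241876); (2097956, 2186); (2505652, 75747); (2232756, 123669);
  (3279284, 4032458); (2571188, 160556); (2243508, 4464168); (3150612, 5355729);
  (3150624, 2304411); (3674292, 183685); (2431412, 30696)].

Definition cert7_cdg : seq (Z * Z) := [::
  (3175056, 12039912); (3150512, 30527); (2517936, 55526); (3154096, 52724); (3959216, 14757);
  (2368016, 15819); (2896016, 17949732); (3170992, 49744); (3174544, 26279); (2118320, 33283);
  (3434928, 15421); (3943344, 21116); (3412112, 4393); (2910640, 6795); (2492560, 6477393);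
  (2519696, 29240957); (2763440, 34940); (2904240, 13316); (2629904, 25452); (2364048, 3592026);
  (2181808, 9485); (2124432, 378928); (3803312, 26323370); (3480496, 14827); (2697904, 89193);
  (2885808, 10269); (3934864, 6565048); (3033776, 230484); (2372240, 2260); (3934384, 14398);
  (3550128, 753); (2099856, 5569392); (3672752, 48300); (2632336, 9774400); (2388112, 25738);
  (2122416, 1553); (3148464, 22208444); (3287472, 4); (2887824, 2372245); (2763408, 11556238);
  (3960976, 2915); (3691184, 10158); (3678480, 60670); (2107824, 30468); (2624176, 34257);
  (2101904, 8699); (2101936, 83228); (2623664, 100391); (3416720, 62644); (2122256, 1721);
  (2106128, 921); (2386608, 9517); (2121904, 28578); (2493072, 36645); (2097168, 19964);
  (3432592, 4326325); (2361520, 9896); (3416208, 7692951); (2246832, 9298); (3412656, 15285);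
  (2367760, 3166854); (2362032, 41494); (2255504, 3255360); (3162288, 28814); (3680688, 40149);
  (3436688, 17195); (2181296, 21435); (2257040, 28287999); (3678864, 31685); (3682960, 6803996);
  (3281584, 14247); (2189744, 1394630); (2108080, 2997); (3828400, 610937); (3410608, 2562);
  (2165680, 2505115); (3943056, 2314974); (3304368, 20857419); (3166896, 120000);
  (3154192, 38657); (2384144, 27393); (3410864, 7232023); (3961520, 990); (2384048, 4839);
  (3170960, 9322); (2097424, 4382); (2230928, 7326379); (3762864, 10525); (3803824, 88602);
  (2386352, 18260); (2517680, 34213); (2105520, 26894); (2108048, 957545); (3811984, 598709);
  (2230416, 938685); (2378416, 25243); (2105872, 3567); (3416848, 13963761); (2697872, 72238);
  (2165168, 994); (3689136, 80441); (2099376, 1285); (3936400, 52270); (3043472, 654035);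
  (2910896, 54687); (2097152, 9); (2173872, 27470); (3025584, 46191); (2114224, 1587);
  (3230384, 103875); (2368048, 400); (2908592, 416); (3148432, 8710978); (2384528, 405910);
  (2240656, 110105); (4025264, 14447); (3500976, 12204); (2642608, 15208); (3690672, 3790231);
  (3558064, 3559535); (2239120, 3501332); (2369968, 40243); (3156912, 25850456);
  (2633872, 2257180); (2702256, 6055); (2367632, 3144); (2912400, 6030); (3541648, 108699);
  (2124720, 18713); (2367664, 7952); (2646192, 12790); (3148208, 29497); (2379952, 2);
  (3287984, 2659038); (2108336, 17668); (2630288, 10543); (3016848, 49430); (3279280, 11945605);
  (2912912, 4416547); (3433232, 15760572); (2493104, 9437988); (2124464, 16951);
  (2503312, 4824509); (2232976, 33509); (3279504, 105249); (2097808, 510181);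
  (3149968, 9486762); (2888336, 54631); (3158160, 9607967); (2361776, 25030); (3154608, 128275);
  (3150480, 4127735); (2630320, 6916); (3433136, 13215); (2121872, 11384); (2101424, 17627);
  (2384016, 50530); (2110096, 16566445); (3154064, 30464); (2642096, 37537); (2765456, 46115);
  (2106000, 78825); (3041936, 608); (2241168, 219666); (3158672, 4224518); (2896560, 52878);
  (3819696, 3); (3426992, 16981); (3678384, 17499); (3935152, 6193); (3956912, 22058);
  (4065424, 8379496); (3429040, 21138); (3672240, 80915); (2452112, 33244); (2384400, 23141);
  (2886064, 41047); (2886320, 10645447); (2384656, 23812); (2239408, 11384759);
  (2230960, 13755632); (2173584, 27540); (2122384, 55046); (3680912, 36904); (2517648, 8467206);
  (2164880, 589325); (2912944, 23361); (2896528, 19180121); (2125968, 12948); (3412624, 4046)].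

Definition cert7 := Cert 10000 [:: (5%N, 1%N, build2 cert7_sq5); (3%N, 2%N, build2 cert7_sq3)]
  (build cert7_deg) (build cert7_cdg).

End Data.

(** * Colourings without a monochromatic double star *)

Lemma leq_cards (T : finType) (A B : {set T}) : A \subset B -> (#|A| <= #|B|)%N.
Proof. exact: subset_leq_card. Qed.

Section Graph.
Variables (V : finType) (n m : nat) (c : {set V} -> bool).

Definition adj k x y := (x != y) && (c [set x; y] == k).

Definition nb k x := [set y | adj k x y].

Lemma adj_sym k : symmetric (adj k).
Proof. by move=> x y; rewrite /adj eq_sym setUC. Qed.

Lemma adj_neg k x y : x != y -> adj (~~ k) x y = ~~ adj k x y.
Proof. by rewrite /adj => ->; case: (c _); case: k. Qed.

(** Apart from the centres, disjoint sets of n leaves at [u] and m leaves at [v] are needed. By the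
    condition of Hall it is enough that the two sets of candidates have at least n and m elements
    and their union at least n + m. *)
Lemma double_star_embedding k u v : adj k u v -> (n < #|nb k u|)%N -> (m < #|nb k v|)%N ->
  (n + m + 2 <= #|nb k u :|: nb k v|)%N ->
  exists2 f : vertex (double_star n m) -> V, injective f &
    forall x y, edge x y -> c [set f x; f y] = k.
Proof.
move=> uv nu mv uvC.
pose X := nb k u :\ v; pose Y := nb k v :\ u.
have cX : (n <= #|X|)%N by have := cardsD1 v (nb k u); rewrite inE uv /X; lia.
have cY : (m <= #|Y|)%N by have := cardsD1 u (nb k v); rewrite inE adj_sym uv /Y; lia.
have cXY : (n + m <= #|X :|: Y|)%N.
  have sub : nb k u :|: nb k v \subset [set u; v] :|: (X :|: Y).
    apply/subsetP => x; rewrite !inE.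
    by case: (x =P u) => //= _; case: (x =P v).
  have := subset_leq_card sub; have [+ _] := leq_card_setU [set u; v] (X :|: Y).
  rewrite cards2; move: uvC; set a := #|_|; set b := #|_|; set d := #|X :|: Y|.
  by case: (u != v) => /=; lia.
(* The candidates outside [X] come first, so that the first m entries take as few vertices from [X]
   as possible. *)
pose sY := enum (Y :\: X) ++ enum (Y :&: X).
have sYE : sY =i Y.
  move=> x; rewrite mem_cat !mem_enum [x \in Y :\: X]in_setD [x \in Y :&: X]in_setI.
  by case: (x \in Y); case: (x \in X).
have usY : uniq sY.
  rewrite cat_uniq !enum_uniq andbT /=; apply/hasPn => x.
  by rewrite !mem_enum !inE => /andP[_ ->].
have ssY : size sY = #|Y| by rewrite -(card_uniqP usY); apply: eq_card.
pose sv := take m sY.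
have usv : uniq sv by rewrite take_uniq.
have ssv : size sv = m by rewrite size_take ssY; case: ltngtP cY.
have csv : #|[set x in sv]| = m by rewrite cardsE (card_uniqP usv).
have cXsv : (n <= #|X :\: [set x in sv]|)%N.
  have := cardsID [set x in sv] X; have := cardsUI X Y.
  have := cardsID X Y; rewrite setIC => cYX cU.
  (* The subtraction is truncated: if [Y] has at least m elements outside [X], no element of [X] is
     taken. Otherwise [X] keeps at least |X| + |Y \ X| - m = |X ∪ Y| - m >= n elements. *)
  suff : (#|X :&: [set x in sv]| <= m - #|Y :\: X|)%N.
    have: (#|X :&: [set x in sv]| <= #|[set x in sv]|)%N.
      by rewrite subset_leq_card // subsetIr.
    by rewrite csv; lia.
  have -> : sv = take m (enum (Y :\: X)) ++ take (m - #|Y :\: X|) (enum (Y :&: X)).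
    rewrite /sv take_cat -cardE; case: ltnP => // lem.
      have -> : (m - #|Y :\: X| = 0)%N by lia.
      by rewrite take0 cats0.
    by rewrite [take m _]take_oversize // -cardE.
  set s2 := take _ (enum (Y :&: X)).
  have : X :&: [set x in take m (enum (Y :\: X)) ++ s2] \subset [set x in s2].
    apply/subsetP => x; rewrite in_setI => /andP[xX]; rewrite !in_set mem_cat => /orP[/mem_take|//].
    by rewrite mem_enum in_setD xX.
  move/subset_leq_card/leq_trans; apply.
  rewrite cardsE; apply: leq_trans (card_size _) _.
  by rewrite size_take; case: ltnP.
pose su := take n (enum (X :\: [set x in sv])).
have ssu : size su = n by rewrite size_take -cardE; case: ltngtP cXsv.
have usu : uniq su by rewrite take_uniq ?enum_uniq.
have suP x : x \in su -> [&& x != v, adj k u x & x \notin sv].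
  by move/mem_take; rewrite mem_enum !inE => /and3P[-> -> ->].
have svP x : x \in sv -> (x != u) && adj k v x.
  by move/mem_take; rewrite sYE !inE.
have nadj x : adj k x x = false by rewrite /adj eqxx.
(* The copy is one duplicate-free list: the two centres, then the n leaves at [u], then the m leaves
   at [v]. Injectivity thus reduces to that of the index map [idx]. *)
pose L := [:: u, v & su ++ sv].
have uL : uniq L.
  have uv' : u != v by case/andP: uv.
  rewrite /L /= inE negb_or uv' !mem_cat !negb_or cat_uniq usu usv /= andbT.
  apply/and3P; split.
  - apply/andP; split; first by apply/negP => /suP; rewrite nadj andbF.
    by apply/negP => /svP; rewrite eqxx.
  - apply/andP; split; first by apply/negP => /suP; rewrite eqxx.
    by apply/negP => /svP; rewrite nadj andbF.
  by apply/hasPn => x xv; apply/negP => /suP; rewrite xv !andbF.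
have sL : size L = (n + m).+2 by rewrite /= size_cat ssu ssv.
pose idx (x : vertex (double_star n m)) : nat :=
  match x with
  | inl None => 0
  | inr None => 1
  | inl (Some i) => i.+2
  | inr (Some j) => (n + j).+2
  end.
have idx_lt x : (idx x < size L)%N.
  by rewrite sL; case: x => -[x|] //=; have := ltn_ord x; lia.
have idx_inj : injective idx.
  case=> [[x|]|[x|]] [[y|]|[y|]] //= exy.
  - by congr (inl (Some _)); apply: val_inj => /=; lia.
  - by have := ltn_ord x; lia.
  - by have := ltn_ord y; lia.
  - by congr (inr (Some _)); apply: val_inj => /=; lia.
exists (fun x => nth u L (idx x)).
  by move=> x y /eqP; rewrite nth_uniq // => /eqP /idx_inj.
have fu (i : 'I_n) : adj k u (nth u L i.+2).
  rewrite /= nth_cat ssu ltn_ord.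
  by have /suP/and3P[] : nth u su i \in su by rewrite mem_nth ?ssu.
have fv (j : 'I_m) : adj k v (nth u L (n + j).+2).
  rewrite /= nth_cat ssu ltnNge leq_addr /= addKn.
  by have /svP/andP[] : nth u sv j \in sv by rewrite mem_nth ?ssv.
have vu : adj k v u by rewrite adj_sym.
have key x y : edge x y -> adj k (nth u L (idx x)) (nth u L (idx y)).
  case: x => -[x|]; case: y => -[y|] //= _; rewrite -?[nth _ _ _]/(nth u L _.+2).
  - by rewrite adj_sym; apply: fu.
  - exact: fu.
  - by rewrite adj_sym; apply: fv.
  - exact: fv.
by move=> x y /key /andP[_ /eqP].
Qed.

Lemma adj_irr k x : adj k x x = false.
Proof. by rewrite /adj eqxx. Qed.

(** * Degrees and common neighbours in the absence of a monochromatic double star *)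

Hypothesis NE : #|V| = (n + 2 * m + 2)%N.
Hypothesis no_copy : forall k (f : vertex (double_star n m) -> V), injective f ->
  ~ forall x y, edge x y -> c [set f x; f y] = k.

Lemma card_unionP k u v : adj k u v -> (n < #|nb k u|)%N -> (m < #|nb k v|)%N ->
  (#|nb k u :|: nb k v| <= n + m + 1)%N.
Proof.
move=> uv nu mv; rewrite leqNgt; apply/negP => H.
have [|f fi] := double_star_embedding uv nu mv; first by lia.
exact: no_copy fi.
Qed.

Lemma card_nbD u : (#|nb true u| + #|nb false u| = n + 2 * m + 1)%N.
Proof.
have := cardsC1 u; have := cardsID (nb true u) [set~ u].
have -> : [set~ u] :&: nb true u = nb true u.
  by apply/setP => x; rewrite !inE /adj eq_sym; case: eqP.
have -> : [set~ u] :\: nb true u = nb false u.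
  by apply/setP => x; rewrite !inE /adj eq_sym; case: eqP => //=; case: (c _).
by lia.
Qed.

Lemma card_nbN k u : (#|nb k u| + #|nb (~~ k) u| = n + 2 * m + 1)%N.
Proof. by case: k; rewrite ?card_nbD // addnC card_nbD. Qed.

(** If [u] had k-degree at most m, it would have more than n + m neighbours in the other colour. A
    double star of that colour centred at [u] is avoided only if all these neighbours have degree at
    most m in that colour. They then have k-degree more than n + m, and two of them joined by an
    edge of colour k are centres of a double star. *)
Lemma min_degree k u : (0 < n)%N -> (m < #|nb k u|)%N.
Proof.
move=> n0; rewrite ltnNge; apply/negP => um.
have uN := card_nbN k u.
have small w : adj (~~ k) u w -> (#|nb (~~ k) w| <= m)%N.
  move=> uw; rewrite leqNgt; apply/negP => wm.
  have := card_unionP uw _ wm; have -> : (n < #|nb (~~ k) u|)%N by lia.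
  move/(_ isT); have : u |: nb (~~ k) u \subset nb (~~ k) u :|: nb (~~ k) w.
    apply/subsetP => x; rewrite !inE => /orP[/eqP->|->] //.
    by rewrite [adj _ w u]adj_sym uw orbT.
  move/leq_cards; rewrite cardsU1 inE adj_irr /=; lia.
have /card_gt0P[w] : (0 < #|nb (~~ k) u|)%N by lia.
rewrite inE => uw; have wm := small _ uw; have wN := card_nbN k w.
have : (0 < #|nb (~~ k) u :\: (w |: nb (~~ k) w)|)%N.
  have := cardsID (w |: nb (~~ k) w) (nb (~~ k) u).
  have := leq_cards (subsetIr (nb (~~ k) u) (w |: nb (~~ k) w)).
  by have := cardsU1 w (nb (~~ k) w); case: (w \notin _) => /=; lia.
case/card_gt0P => z; rewrite !inE negb_or => /andP[/andP[zw nwz] uz].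
have zm := small _ uz; have zN := card_nbN k z.
have wz : adj k w z.
  have := adj_neg k (x := w) (y := z); rewrite eq_sym zw => /(_ isT).
  by case: (adj k w z) => // H; move: nwz; rewrite H.
have := @card_unionP k w z wz; have -> : (n < #|nb k w|)%N by lia.
have -> : (m < #|nb k z|)%N by lia.
move=> /(_ isT isT); have : z |: nb k z \subset nb k w :|: nb k z.
  by apply/subsetP => x; rewrite !inE => /orP[/eqP->|->]; rewrite ?wz ?orbT.
by move/leq_cards; rewrite cardsU1 inE adj_irr /=; lia.
Qed.

(** The k-neighbourhoods of [u] and [v] cover at most n + m + 1 vertices, among them [u] and [v]
    themselves; each of the at least m + 1 others is joined to both in the other colour. *)
Lemma codegree k u v : (0 < n)%N -> adj k u v -> (n < #|nb k u|)%N ->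
  (m < #|nb (~~ k) u :&: nb (~~ k) v|)%N.
Proof.
move=> n0 uv nu; have U := card_unionP uv nu (min_degree k v n0).
have : ~: (nb k u :|: nb k v) \subset nb (~~ k) u :&: nb (~~ k) v.
  apply/subsetP => x; rewrite !inE negb_or => /andP[nux nvx].
  have ux : u != x by apply: contraNneq nvx => <-; rewrite adj_sym.
  have vx : v != x by apply: contraNneq nux => <-.
  by rewrite !adj_neg // nux.
by move/leq_cards; have := cardsC (nb k u :|: nb k v); have := NE; lia.
Qed.

Lemma sum_nbI k (A B : {set V}) :
  (\sum_(x in A) #|nb k x :&: B| = \sum_(y in B) #|nb k y :&: A|)%N.
Proof.
have E (C D : {set V}) :
    (\sum_(x in C) #|nb k x :&: D| = \sum_(x in C) \sum_(y in D) adj k x y)%N.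
  apply: eq_bigr => x _; rewrite -sum1_card [LHS]big_mkcond [RHS]big_mkcond.
  by apply: eq_bigr => y _; rewrite !inE andbC; case: (y \in D); case: adj.
by rewrite !E exchange_big; apply: eq_bigr => x _; apply: eq_bigr => y _; rewrite adj_sym.
Qed.

Lemma edges_lb k u : (0 < n)%N -> (n < #|nb k u|)%N ->
  (#|nb k u| * m.+1 <= \sum_(y in nb (~~ k) u) #|nb (~~ k) y :&: nb k u|)%N.
Proof.
move=> n0 nu; rewrite -sum_nbI -sum_nat_const; apply: leq_sum => w.
by rewrite inE => uw; rewrite setIC; apply: codegree.
Qed.

Lemma card_nbI k u y : adj (~~ k) u y ->
  (#|nb k y :&: nb k u| + #|nb (~~ k) y :&: nb k u| = #|nb k u|)%N.
Proof.
move=> uy; rewrite -(cardsID (nb k y) (nb k u)) setIC; congr (_ + _)%N.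
apply: eq_card => x; rewrite !inE; case ux: (adj k u x); rewrite ?andbF ?andbT //.
apply: adj_neg; apply: contraTneq ux => <-.
by rewrite -[k in adj k]negbK adj_neg ?uy //; case/andP: uy.
Qed.

(* Count the pairs between the two neighbourhoods of [u]: each vertex of either one
   has more than [m] neighbours, in the opposite colour, in the other one. *)
Lemma not_both_big u : (n <= 2 * m + 2)%N -> (0 < n)%N ->
  (n < #|nb true u|)%N -> (n < #|nb false u|)%N -> False.
Proof.
move=> nm n0 tu fu; have Et := edges_lb n0 tu; have Ef := edges_lb n0 fu.
have := card_nbD u.
have : (\sum_(y in nb false u) #|nb false y :&: nb true u| +
        \sum_(y in nb false u) #|nb true y :&: nb true u| =
        #|nb false u| * #|nb true u|)%N.
  rewrite -big_split /= -sum_nat_const; apply: eq_bigr => y; rewrite inE => uy.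
  by rewrite addnC; apply: card_nbI.
(* With t and f the two degrees of [u], this reads (t + f)(m + 1) <= t f <= (t + f)^2 / 4, so t + f
   >= 4m + 4, whereas t + f = n + 2m + 1 <= 4m + 3. *)
rewrite [X in (_ + X)%N]sum_nbI; move: Et Ef => /=; nia.
Qed.

(** Suppose that [u] has k-degree d > n, and let y be a neighbour in the other colour. If y has
    degree more than n in that colour, [codegree] leaves it at most d - (m + 1) such neighbours
    among the k-neighbours of [u]; otherwise it has at most n - 1 = 2m of them, as [u] is a further
    one. The lower bound of [edges_lb] is then too large. *)
Lemma small_regular k u : n = (2 * m + 1)%N -> (m <= 2)%N -> (#|nb k u| <= n)%N.
Proof.
move=> nm m2; rewrite leqNgt; apply/negP => nu; have n0 : (0 < n)%N by lia.
have := edges_lb n0 nu; have := card_nbN k u; have := min_degree (~~ k) u n0.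
have : (\sum_(y in nb (~~ k) u) #|nb (~~ k) y :&: nb k u| <=
        #|nb (~~ k) u| * maxn (2 * m) (#|nb k u| - m.+1))%N.
  rewrite -sum_nat_const; apply: leq_sum => y; rewrite inE => uy.
  have yu : adj (~~ k) y u by rewrite adj_sym.
  rewrite leq_max; case: (ltnP n #|nb (~~ k) y|) => ny; apply/orP; [right|left].
    by have := codegree n0 yu ny; rewrite negbK; have := card_nbI uy; lia.
  have : u |: (nb (~~ k) y :&: nb k u) \subset nb (~~ k) y.
    by apply/subsetP => x; rewrite !inE => /orP[/eqP->|/andP[]].
  by move/leq_cards; rewrite cardsU1 !inE adj_irr andbF /=; lia.
(* By [min_degree], d <= 3m + 1, so the maximum is 2m. Then d(m + 1) <= 2m(4m + 2 - d) with d >= 2m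
   + 2 gives (m + 1)^2 <= 2m^2, which fails for m <= 2. *)
case: (ltngtP (2 * m) (#|nb k u| - m.+1))%N => [lt|lt|->]; rewrite ?maxnn;
  case: m m2 nm nu lt => [|[|[|//]]] /=; nia.
Qed.

Lemma even_sum_nb k : ~~ odd (\sum_u #|nb k u|).
Proof.
(* Handshake argument: orienting each edge by rank, it is counted once from its lower and once from
   its upper end. *)
pose G x y : nat := (enum_rank x < enum_rank y)%N && adj k x y.
rewrite (eq_bigr (fun x => \sum_y G x y + \sum_y G y x)%N); last first.
  move=> x _; rewrite -big_split -sum1_card [LHS]big_mkcond.
  apply: eq_bigr => y _; rewrite inE /G (adj_sym k y x).
  by case: ltngtP => [||/val_inj/enum_rank_inj->]; rewrite ?adj_irr //; case: adj.
by rewrite big_split /= [X in (_ + X)%N]exchange_big addnn odd_double.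
Qed.

End Graph.

(** * The flag algebra contradiction *)

Lemma swaps_perm k : (k <= 7)%N -> all (perm_eq^~ (iota 0 k)) (swaps k).
Proof.
have /allP sw : all (fun k => all (perm_eq^~ (iota 0 k)) (swaps k)) (iota 0 8) by vm_compute.
by move=> k7; apply: sw; rewrite mem_iota.
Qed.

Definition both_loops (s : seq bool) := (true \in s) && (false \in s).

Lemma check_cert4 :
  check both_loops (Zpos 1699) (Zpos 1000) (Zpos 3699) [:: false; true] 4
    (kappa cert4) (grams cert4) (degs cert4) (cdgs cert4).
Proof. by vm_cast_no_check (erefl true). Qed.

Lemma check_cert7 :
  check xpredT (Zpos 1699) (Zpos 1000) (Zpos 3699) [:: false] 7
    (kappa cert7) (grams cert7) (degs cert7) (cdgs cert7).
Proof. by vm_cast_no_check (erefl true). Qed.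

Section Flags.
Variable V : finType.
Implicit Types (e : V -> V -> bool) (x y : V).

(* The value [e x x] is the colour of the loop at [x]. *)
Definition few_differ e := forall x,
  (3699 * #|[set y | e x y != e x x]| <= 1699 * #|V|)%N.

(** The case [y = x] is included and bounds from below the number of edges at [x] that differ from
    its loop. *)
Definition many_common e := forall x y, e x y = e x x ->
  (1000 * #|V| <= 3699 * #|[set z | (e x z != e x x) && (e y z != e x x)]|)%N.

Lemma few_differZ e : few_differ e -> forall x,
  Zpos 3699 * #|[set y | e x y != e x x]|%:R <= Zpos 1699 * #|V|%:R :> Z.
Proof. by move=> H x; have := H x; rewrite -(ler_nat Z) !natrM. Qed.

Lemma many_commonZ e : many_common e -> forall x y, e x y = e x x ->
  Zpos 1000 * #|V|%:R <=
  Zpos 3699 * #|[set z | (e x z != e x x) && (e y z != e x x)]|%:R :> Z.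
Proof. by move=> H x y /H; rewrite -(ler_nat Z) !natrM. Qed.

Lemma loops_constant e x y : symmetric e -> few_differ e -> many_common e -> e x x = e y y.
Proof.
move=> e_sym /few_differZ degP /many_commonZ cdgP.
have lsP z : e z z \in [:: false; true] by case: (e z z).
have critP s s' : perm_eq s s' -> both_loops s = both_loops s'.
  by move=> ss'; rewrite /both_loops !(perm_mem ss').
have ok4 : cert_ok 4 cert4 by vm_compute.
have sw k : (k <= 4)%N -> all (perm_eq^~ (iota 0 k)) (swaps k).
  by move=> k4; apply: swaps_perm; lia.
(* Any 4-tuple containing both vertices would do; repetitions are harmless. *)
have := @check_sound V e _ _ _ _ e_sym lsP degP cdgP both_loops 4 cert4
  [:: x; y; x; y] isT erefl critP ok4 sw check_cert4.
by rewrite /both_loops !inE /=; case: (e x x); case: (e y y).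
Qed.

Lemma loopless_empty e x : symmetric e -> few_differ e -> many_common e ->
  (forall y, e y y = false) -> False.
Proof.
move=> e_sym /few_differZ degP /many_commonZ cdgP e0.
have lsP z : e z z \in [:: false] by rewrite e0.
have ok7 : cert_ok 7 cert7 by vm_compute.
by have := @check_sound V e _ _ _ _ e_sym lsP degP cdgP xpredT 7 cert7
  (nseq 7 x) isT erefl (fun _ _ _ => erefl) ok7 swaps_perm check_cert7.
Qed.

Lemma flag_empty e x : symmetric e -> few_differ e -> many_common e -> False.
Proof.
move=> e_sym degP cdgP.
have loops y : e y y = e x x by apply: loops_constant.
case exx: (e x x); last by apply: (loopless_empty x e_sym) => // y; rewrite loops.
have neq b1 b2 : (~~ b1 != ~~ b2) = (b1 != b2) by case: b1; case: b2.
(* Both families of inequalities only compare colours with that of a loop, so they survive the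
   exchange of the two colours. *)
apply: (@loopless_empty (fun y z => ~~ e y z) x).
- by move=> y z; rewrite e_sym.
- move=> y; have := degP y; congr (3699 * _ <= _)%N.
  by apply: eq_card => z; rewrite !inE neq.
- move=> y z /negb_inj/cdgP; congr (_ <= 3699 * _)%N.
  by apply: eq_card => w; rewrite !inE !neq.
by move=> y; rewrite loops exx.
Qed.

End Flags.

(** * From colourings to looped graphs, and the remaining small cases *)

Section Main.
Variables (V : finType) (n m : nat) (c : {set V} -> bool).
Hypothesis NE : #|V| = (n + 2 * m + 2)%N.
Hypothesis mn : (m <= n)%N.
Hypothesis nm : (1000 * n <= 1699 * m.+1)%N.
Hypothesis no_copy : forall k (f : vertex (double_star n m) -> V), injective f ->
  ~ forall x y, edge x y -> c [set f x; f y] = k.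

Lemma dense_contradiction : (0 < n)%N -> (n <= 2 * m)%N -> False.
Proof.
move=> n0 n2m.
(* [l u] is the colour in which [u] has degree more than n. There is one because the two degrees add
   up to n + 2m + 1 > 2n, and only one by [not_both_big]. *)
pose l u := (#|nb c false u| <= n)%N.
pose e u v := if u == v then l u else c [set u; v].
have exx u : e u u = l u by rewrite /e eqxx.
have small u : (#|nb c (~~ l u) u| <= n)%N.
  case lu: (l u) => //=; rewrite leqNgt; apply/negP => tu.
  have fu : (n < #|nb c false u|)%N by rewrite ltnNge -/(l u) lu.
  by apply: (not_both_big NE no_copy _ n0 tu fu); lia.
have big u : (n < #|nb c (l u) u|)%N.
  by have := card_nbN c NE (l u) u; have := small u; lia.
have eE u v : (e u v != l u) = adj c (~~ l u) u v.
  rewrite /e /adj; case: (u =P v) => [->|_]; first by rewrite eqxx.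
  by case: (c _); case: (l u).
have x : V by apply: (@enum_val _ V); exists 0%N; rewrite NE; lia.
apply: (@flag_empty V e x).
- by move=> u v; rewrite /e eq_sym setUC; case: eqP => // ->.
- move=> u; rewrite exx; have -> : [set v | e u v != l u] = nb c (~~ l u) u.
    by apply/setP => v; rewrite !inE eE.
  (* With N = n + 2(m + 1), both 3699 n <= 1699 N and 1000 N <= 3699 (m + 1) amount to the
     hypothesis [nm]; this is the origin of 3699 = 1699 + 2 * 1000. *)
  by have := small u; rewrite NE; lia.
move=> u v; rewrite exx => uv.
suff : (m < #|[set z | (e u z != l u) && (e v z != l u)]|)%N by rewrite NE; lia.
have [->|nuv] := eqVneq v u.
  have := min_degree NE no_copy (~~ l u) u n0; congr (_ < _)%N.
  by apply: eq_card => z; rewrite !inE eE andbb.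
have au : adj c (l u) u v by move: uv; rewrite /e /adj eq_sym (negbTE nuv) => ->; rewrite eqxx.
have := codegree NE no_copy n0 au (big u).
move/leq_trans; apply; apply: subset_leq_card; apply/subsetP => z.
rewrite !inE eE => /andP[-> /=]; rewrite /adj /e => /andP[/negbTE-> /eqP->].
by case: (l u).
Qed.

Lemma colouring_contradiction : False.
Proof.
have [n0|n0] := posnP n.
  (* For n = m = 0 the double star is a single edge and N = 2. *)
  have m0 : m = 0%N by lia.
  have /card_gt1P[u [v [_ _ uv]]] : (1 < #|V|)%N by lia.
  have auv : adj c (c [set u; v]) u v by rewrite /adj uv eqxx.
  have avu : adj c (c [set u; v]) v u by rewrite adj_sym.
  have [| | |f fi] := double_star_embedding (n := n) (m := m) auv; last exact: no_copy fi.
  - by rewrite n0; apply/card_gt0P; exists v; rewrite inE.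
  - by rewrite m0; apply/card_gt0P; exists u; rewrite inE.
  rewrite n0 m0; apply/card_gt1P; exists u, v; split=> //.
    by rewrite !inE avu orbT.
  by rewrite !inE auv.
case: (leqP n (2 * m)) => n2m; first exact: dense_contradiction.
(* For n >= 2m + 1 the hypothesis [nm] leaves only n = 2m + 1 with 301 m <= 699. *)
have En : n = (2 * m + 1)%N by lia.
have m2 : (m <= 2)%N by lia.
(* The two degrees add up to 2n and neither exceeds n. *)
have reg u : #|nb c true u| = n.
  have := small_regular NE no_copy true u En m2.
  have := small_regular NE no_copy false u En m2.
  by have := card_nbD c NE u; lia.
(* Both the common degree n = 2m + 1 and the number N = 4m + 3 of vertices are odd, so the sum of
   the degrees would be odd. *)
have := even_sum_nb c true; rewrite (eq_bigr (fun _ => n)) //.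
by rewrite sum_nat_const NE En; apply/negP; rewrite negbK oddM; lia.
Qed.

End Main.

(** As 1699 and 1000 are coprime, they are the numerator and denominator of the decimal literal in
    lowest terms. *)
Lemma ratio1699 : 1.699%Q = 1699%:R / 1000%:R :> rat.
Proof.
rewrite -[LHS]divq_num_den.
have -> : numq 1.699%Q = Posz 1699 by reflexivity.
have -> : denq 1.699%Q = Posz 1000 by reflexivity.
by rewrite -!pmulrn.
Qed.

Lemma ler_ratioMl (F : numFieldType) (q a b x y : F) :
  0 < b -> q = a / b -> x <= q * y -> b * x <= a * y.
Proof. by move=> b0 ->; rewrite mulrAC ler_pdivlMr // mulrC. Qed.

Theorem theorem1p5 (m n : nat) (hmn : (m <= n)%N)
    (hn : (n%:R : rat) <= 1.699%Q * (m%:R + 1)) :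
  (ramsey (double_star n m) <= n + 2 * m + 2)%N.
Proof.
have nm : (1000 * n <= 1699 * m.+1)%N.
  rewrite -(ler_nat rat) !natrM -[m.+1]addn1 natrD.
  exact: ler_ratioMl (ltr0Sn _ 999) ratio1699 hn.
(* By minimality it is enough that every colouring on n + 2m + 2 vertices contains a monochromatic
   copy. *)
rewrite /ramsey; case: ex_minnP => r _; apply.
apply/forallP => c; apply: contraT; rewrite negb_exists => /forallP nocopy; exfalso.
apply: (@colouring_contradiction 'I_(n + 2 * m + 2) n m c).
- by rewrite card_ord.
- exact: hmn.
- exact: nm.
move=> k f fi H; case/negP: (nocopy k); apply/existsP; exists [ffun x => f x].
apply/andP; split; first by apply/injectiveP => x y; rewrite !ffunE => /fi.
apply/forallP => x; apply/forallP => y; apply/implyP => xy.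
by rewrite !ffunE H.
Qed.
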